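(* Let $\Gamma$ be a congruence subgroup of $PSL_2(\mathbb Z)$, $k>1$, $z_0\in\mathfrak H$, and $\omega=(X-\tau)^{2k-2}g_{k,z_0}(\tau)\,d\tau$. Let $I\colon\mathfrak H\setminus\Gamma z_0\to V_{2k-2}/\mathrm i^kV^{\mathbb R}_{2k-2}$ be any function that is locally the reduction modulo $\mathrm i^kV^{\mathbb R}_{2k-2}$ of a smooth $V_{2k-2}$-valued function $h$ with $dh=\omega$ and satisfies $I(\gamma\tau)=\gamma I(\tau)$ for all $\gamma\in\Gamma$. Then for every $z\in\mathfrak H\setminus\Gamma z_0$, \[ \tfrac12G_k^{\mathfrak H/\Gamma}(z,z_0)=\frac{(-1)^{k-1}}{(k-1)!}\,\Re\big(I(z),Q_z^{k-1}\big). \]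
   Context: $\mathfrak H$ is the upper half-plane. For a smooth function $f$ of weight $w$, $\delta f=\partial f/\partial z+\frac w{z-\bar z}f$ (weight $w+2$); for weight $0$, $\delta^kf=\delta_{2k-2}\cdots\delta_0f$. $\Delta=(z-\bar z)^2\partial_z\partial_{\bar z}=-y^2(\partial_x^2+\partial_y^2)$. The Green function $G_k^{\mathfrak H/\Gamma}$ is the unique function on $\{(z_1,z_2):z_1\notin\Gamma z_2\}$ that is smooth, real-valued, $\Gamma$-invariant in each variable, satisfies $\Delta_jG=k(1-k)G$ in each variable, $G=m\log|z_1-z_2|^2+O(1)$ as $z_1\to z_2$ ($m$ = order of stabilizer of $z_2$ in $\Gamma$), and $G\to0$ as $z_1$ tends to a cusp. $g_{k,z_0}(z)=\delta^kG_k^{\mathfrak H/\Gamma}(z,z_0)$. $V_{2k-2}$: complex polynomials in $X$ of degree $\le2k-2$, $V^{\mathbb R}_{2k-2}$ the real ones; $\gamma p=p|\gamma^{-1}$ with $(p|\gamma)(X)=p(\frac{aX+b}{cX+d})(cX+d)^{2k-2}$; pairing $(\sum p_iX^i,\sum q_iX^i)=\sum_i(-1)^ip_iq_{2k-2-i}/\binom{2k-2}i$. $Q_z(X)=\frac{(X-z)(X-\bar z)}{z-\bar z}$; $Q_z^{k-1}\in\mathrm i^{k-1}V^{\mathbb R}_{2k-2}$, so the real part in the claim is well defined. *)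

(* Defs.v *)
From HB Require Import structures.
From mathcomp Require Import all_boot all_order all_algebra.
From mathcomp Require Import complex.
From mathcomp Require Import finmap.
From mathcomp Require Import all_classical all_reals all_analysis.

Set Implicit Arguments.
Unset Strict Implicit.
Unset Printing Implicit Defensive.
Import Order.TTheory GRing.Theory Num.Theory.
Import numFieldNormedType.Exports.

Local Open Scope classical_set_scope.
Local Open Scope ring_scope.

(* Complex numbers are [Rcomplex R], which is at once a field and an
   R-module normed by the R-valued modulus.  The instances below make it a
   normed R-module, so that [derivable], ['D_v] etc. on it are real-linear
   notions on the plane. *)
Section Rcomplex_normedModType.
Variable R : realType.

HB.instance Definition _ :=
  PseudoMetric.copy (Rcomplex R) (pseudoMetric_normed (Rcomplex R)).
HB.instance Definition _ := isPointed.Build (Rcomplex R) 0.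
HB.instance Definition _ :=
  NormedZmod_PseudoMetric_eq.Build R (Rcomplex R) erefl.

Lemma Rcomplex_normrZ (l : R) (x : Rcomplex R) : `|l *: x| = `|l| * `|x|.
Proof.
case: x => a b; change (Normc.normc ((l * a) +i* (l * b))%C =
  `|l| * Normc.normc (a +i* b)%C) => /=.
by rewrite !exprMn -mulrDr sqrtrM ?sqr_ge0// sqrtr_sqr.
Qed.

HB.instance Definition _ :=
  PseudoMetricNormedZmod_Lmodule_isNormedModule.Build R (Rcomplex R)
    Rcomplex_normrZ.
End Rcomplex_normedModType.

Section Smooth.
Context {R : realType} {V W : normedModType R}.

Fixpoint Cn (n : nat) (U : set V) (f : V -> W) : Prop :=
  match n with
  | 0 => forall x, U x -> {for x, continuous f}
  | m.+1 => (forall x v, U x -> derivable f x v) /\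
            (forall v, Cn m U ('D_v f))
  end.

Definition smooth (U : set V) (f : V -> W) : Prop := forall n, Cn n U f.

End Smooth.

Section Defs.
Context {R : realType}.
Local Notation C := (Rcomplex R).

Definition ii : C := Complex 0 1.
Definition ofreal (x : R) : C := Complex x 0.
Definition cbar (z : C) : C := conjc z.

Definition upper : set C := [set z | 0 < complex.Im z].

Definition dz (f : C -> C) (z : C) : C :=
  2^-1 * ('D_(1 : C) f z - ii * 'D_ii f z).
Definition dzbar (f : C -> C) (z : C) : C :=
  2^-1 * ('D_(1 : C) f z + ii * 'D_ii f z).

Definition delta (w : nat) (f : C -> C) (z : C) : C :=
  dz f z + w%:R / (z - cbar z) * f z.

(* The n-fold iterate starting in weight 0; each step raises the weight
   by 2. *)
Fixpoint deltan (n : nat) (f : C -> C) : C -> C :=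
  if n is m.+1 then delta (2 * m) (deltan m f) else f.

Definition laplacian (f : C -> C) (z : C) : C :=
  (z - cbar z) ^+ 2 * dz (dzbar f) z.

Definition mob (g : 'M[int]_2) (z : C) : C :=
  ((g 0 0)%:~R * z + (g 0 1)%:~R) / ((g 1 0)%:~R * z + (g 1 1)%:~R).

(* A subgroup of PSL_2(Z) is represented by its preimage in SL_2(Z), i.e. by
   a subgroup of SL_2(Z) containing -1; [Gamma] contains the image of the
   principal congruence subgroup of some level N iff its preimage contains
   that subgroup. *)
Record congruence_subgroup (Gamma : set 'M[int]_2) : Prop := {
  cong_det : forall g, Gamma g -> \det g = 1;
  cong_1 : Gamma 1;
  cong_M : forall g h, Gamma g -> Gamma h -> Gamma (g * h);
  cong_V : forall g, Gamma g -> Gamma g^-1;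
  cong_N1 : Gamma (-1);
  cong_level : exists2 N : nat, (0 < N)%N &
    forall g : 'M[int]_2, \det g = 1 ->
      (forall i j, (N%:Z %| (g - 1) i j)%Z) -> Gamma g }.

(* The division by 2 passes from the preimage in SL_2(Z) to PSL_2(Z). *)
Definition stab_order (Gamma : set 'M[int]_2) (z : C) : nat :=
  (#|` fset_set [set g | Gamma g /\ mob g z = z]| %/ 2)%N.

Definition off_orbit (Gamma : set 'M[int]_2) (z0 : C) : set C :=
  [set z | upper z /\ ~ exists2 g, Gamma g & z = mob g z0].

(* The values of [G] outside [{(z1, z2) in H x H | z1 notin Gamma z2}] are
   irrelevant.  Cusps are the points [s oo] with s in SL_2(Z), with the
   images under s of the half-planes [Im z > Y] as punctured neighbourhoods. *)
Record is_green (k : nat) (Gamma : set 'M[int]_2) (G : C -> C -> R) : Prop := {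
  green_smooth : smooth
    [set p : (C * C)%type | upper p.2 /\ off_orbit Gamma p.2 p.1]
    (fun p : (C * C)%type => G p.1 p.2 : R^o);
  green_inv1 : forall z1 z2 g, upper z2 -> off_orbit Gamma z2 z1 -> Gamma g ->
    G (mob g z1) z2 = G z1 z2;
  green_inv2 : forall z1 z2 g, upper z2 -> off_orbit Gamma z2 z1 -> Gamma g ->
    G z1 (mob g z2) = G z1 z2;
  green_eigen1 : forall z1 z2, upper z2 -> off_orbit Gamma z2 z1 ->
    laplacian (fun z => ofreal (G z z2)) z1 =
      k%:R * (1 - k%:R) * ofreal (G z1 z2);
  green_eigen2 : forall z1 z2, upper z2 -> off_orbit Gamma z2 z1 ->
    laplacian (fun z => ofreal (G z1 z)) z2 =
      k%:R * (1 - k%:R) * ofreal (G z1 z2);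
  green_log : forall z2, upper z2 -> exists M : R,
    \forall z1 \near z2, off_orbit Gamma z2 z1 ->
      `|G z1 z2 - (stab_order Gamma z2)%:R * ln (`|z1 - z2| ^+ 2)| <= M;
  green_cusp : forall z2 (s : 'M[int]_2), upper z2 -> \det s = 1 ->
    forall e : R, 0 < e -> exists Y : R, forall z : C, Y < complex.Im z ->
      off_orbit Gamma z2 (mob s z) -> `|G (mob s z) z2| < e }.

Definition gk (k : nat) (G : C -> C -> R) (z0 : C) : C -> C :=
  deltan k (fun z => ofreal (G z z0)).

Definition Vpoly (k : nat) : set {poly C} :=
  [set p | (size p <= (2 * k - 2).+1)%N].
Definition VpolyR (k : nat) : set {poly C} :=
  [set p | Vpoly k p /\ forall i, complex.Im p`_i = 0].

(* An element of the quotient of [Vpoly k] by [i^k VpolyR k] is a coset,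
   as a set of polynomials. *)
Definition coset_iR (k : nat) (p : {poly C}) : set {poly C} :=
  [set p + ii ^+ k *: r | r in VpolyR k].

(* p((aX+b)/(cX+d)) (cX+d)^(2k-2), with denominators cleared. *)
Definition slash (k : nat) (p : {poly C}) (g : 'M[int]_2) : {poly C} :=
  \sum_(i < (2 * k - 2).+1)
    p`_i *: (((g 0 0)%:~R *: 'X + ((g 0 1)%:~R)%:P) ^+ i
             * ((g 1 0)%:~R *: 'X + ((g 1 1)%:~R)%:P) ^+ (2 * k - 2 - i)).
Definition act (k : nat) (g : 'M[int]_2) (p : {poly C}) : {poly C} :=
  slash k p g^-1.

Definition pairing (k : nat) (p q : {poly C}) : C :=
  \sum_(i < (2 * k - 2).+1)
    (-1) ^+ i * p`_i * q`_(2 * k - 2 - i) / ('C(2 * k - 2, i))%:R.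

Definition Qz (z : C) : {poly C} :=
  (z - cbar z)^-1 *: (('X - z%:P) * ('X - (cbar z)%:P)).

(* The coefficient of dtau in (X - tau)^(2k-2) g(tau) dtau. *)
Definition omega (k : nat) (g : C -> C) (t : C) : {poly C} :=
  g t *: ('X - t%:P) ^+ (2 * k - 2).

(* On N: h is smooth with values in [Vpoly k] and dh = w(tau) dtau; as dtau
   takes the value v on a tangent vector v, the latter says that the
   derivative of h along v is v w. *)
Definition primitive_on (k : nat) (N : set C) (w h : C -> {poly C}) : Prop :=
  [/\ forall t, N t -> Vpoly k (h t),
      forall i : nat, smooth N (fun t => (h t)`_i) &
      forall t (v : C) (i : nat), N t ->
        'D_v (fun s => (h s)`_i) t = (v *: w t)`_i].

Definition local_primitive (k : nat) (U : set C) (w : C -> {poly C})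
    (I : C -> set {poly C}) : Prop :=
  forall t, U t -> exists (N : set C) (h : C -> {poly C}),
    [/\ open N, N t, N `<=` U, primitive_on k N w h &
        forall s, N s -> I s = coset_iR k (h s)].

End Defs.

(* Main.v *)
(* Write k = K + 1, r = z - zbar, c = (-1)^K / K!, and let
   D(z) = c Re (I(z), Q_z^K) - G(z, z0) / 2, a well-defined Gamma-invariant real
   function off the orbit; we show that E = r^K D vanishes.  Locally E is a
   combination of r^K G and of (h, (X - z)^K (X - zbar)^K) and its conjugate, where
   dh = omega.  Since ((X - z)^(2K), q) = q(z), differentiating the pairing k times
   in z gives (-1)^K K! r^K g_k, while Bol's identity
   r^K delta^k G = (d/dz)^k (r^K G) treats the other term, and the two cancel:
   (d/dz)^k E = 0, and (d/dzbar)^k E = 0 because D is real.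

   Hence E is polynomial along every horizontal or vertical line that misses the
   orbit, and almost all of them do, the orbit being countable.  Invariance under
   z -> z + M makes D independent of Re z, so y^K D(z) = q(y) with q a polynomial;
   invariance under z -> z / (M z + 1) then forces q = d y^K.  Thus D is constant,
   and the eigenvalue equation, k (1 - k) being nonzero, forces D = 0. *)
Require Import Defs.
From mathcomp Require Import all_boot all_order all_algebra.
From mathcomp Require Import complex.
From mathcomp Require Import all_classical all_reals all_analysis.
From mathcomp Require Import ring lra zify.

Set Implicit Arguments.
Unset Strict Implicit.
Unset Printing Implicit Defensive.
Import Order.TTheory GRing.Theory Num.Theory.
Import numFieldNormedType.Exports.

Local Open Scope classical_set_scope.
Local Open Scope ring_scope.

(** * The complex plane as a normed real vector space *)

Section RcomplexTheory.
Variable R : realType.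
Local Notation C := (Rcomplex R).
Local Notation Re := (@complex.Re R : C -> R).
Local Notation Im := (@complex.Im R : C -> R).

(** The factor [rr ^+ K] turns both differential operators into plain derivatives: it clears the
    denominator of [Qz z ^+ K] and, through Bol's identity, absorbs the weight terms of [deltan].
    Since dz and dzbar commute, a word of 2K + 1 letters in them contains one of the two at least k
    times, hence kills E; so every combination of dz and dzbar with constant coefficients is
    nilpotent on E. The obstacle is that all this holds only off the orbit, where local solution
    formulas do not globalize by themselves. Along a line inside that set, one-variable calculus
    gives a single polynomial for the whole line. Countability of the integral matrices supplies
    such lines, and continuity of E reaches the points that lie on no good line. The k-th order
    equations cannot exclude a constant D, because r^K has degree K in z and in zbar. This is why a
    second-order equation is carried along: in terms of E the eigenvalue equation becomes the
    Euler-Darboux equation, which the pairing term and its conjugate satisfy on their own. *)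

Lemma Rc_normE (z : C) : `|z| = Num.sqrt (Re z ^+ 2 + Im z ^+ 2).
Proof. by case: z. Qed.

Lemma le_norm_Re (z : C) : `|Re z| <= `|z|.
Proof. by rewrite Rc_normE -sqrtr_sqr ler_sqrt ?addr_ge0 ?sqr_ge0// lerDl sqr_ge0. Qed.

Lemma le_norm_Im (z : C) : `|Im z| <= `|z|.
Proof. by rewrite Rc_normE -sqrtr_sqr ler_sqrt ?addr_ge0 ?sqr_ge0// lerDr sqr_ge0. Qed.

Lemma le_norm_ReIm (z : C) : `|z| <= `|Re z| + `|Im z|.
Proof.
rewrite Rc_normE -[leRHS]ger0_norm ?addr_ge0// -sqrtr_sqr ler_sqrt ?sqr_ge0//.
rewrite -(real_normK (num_real (Re z))) -(real_normK (num_real (Im z))).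
by rewrite sqrrD lerD2r lerDl mulrn_wge0// mulr_ge0.
Qed.

Lemma eq_Rc (z w : C) : Re z = Re w -> Im z = Im w -> z = w.
Proof. by case: z w => [a b] [c d] /= -> ->. Qed.

Lemma Rc_ReD (z w : C) : Re (z + w) = Re z + Re w. Proof. by case: z w => [a b] []. Qed.
Lemma Rc_ImD (z w : C) : Im (z + w) = Im z + Im w. Proof. by case: z w => [a b] []. Qed.
Lemma Rc_ReN (z : C) : Re (- z) = - Re z. Proof. by case: z. Qed.
Lemma Rc_ImN (z : C) : Im (- z) = - Im z. Proof. by case: z. Qed.
Lemma Rc_ReM (z w : C) : Re (z * w) = Re z * Re w - Im z * Im w.
Proof. by case: z w => [a b] []. Qed.
Lemma Rc_ImM (z w : C) : Im (z * w) = Re z * Im w + Im z * Re w.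
Proof. by case: z w => [a b] []. Qed.
Lemma Rc_ReZ (a : R) (z : C) : Re (a *: z) = a * Re z. Proof. by case: z. Qed.
Lemma Rc_ImZ (a : R) (z : C) : Im (a *: z) = a * Im z. Proof. by case: z. Qed.

Lemma cvg_Rc (T : Type) (F : set_system T) (FF : Filter F) (f : T -> C) (l : C) :
  f @ F --> l <-> (Re \o f @ F --> Re l) /\ (Im \o f @ F --> Im l).
Proof.
split=> [/cvgrPdist_le fl|[/cvgrPdist_le fr /cvgrPdist_le fi]].
  split; apply/cvgrPdist_le => e e0; near=> x.
    rewrite /= -Rc_ReN -Rc_ReD (le_trans (le_norm_Re _))//.
    by near: x; exact: fl.
  rewrite /= -Rc_ImN -Rc_ImD (le_trans (le_norm_Im _))//.
  by near: x; exact: fl.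
apply/cvgrPdist_le => e e0; near=> x.
rewrite (le_trans (le_norm_ReIm _))// [e]splitr Rc_ReD Rc_ReN Rc_ImD Rc_ImN lerD//.
  by near: x; apply: fr; rewrite divr_gt0.
by near: x; apply: fi; rewrite divr_gt0.
Unshelve. all: by end_near. Qed.

Lemma is_derive_cvgP (V W : normedModType R) (f : V -> W) (x v : V) (df : W) :
  is_derive x v f df <->
  (fun h : R => h^-1 *: (f (h *: v + x) - f x)) @ 0^' --> df.
Proof.
split=> [[cf <-]|cf]; first exact: cf.
by split; [apply/cvg_ex; exists df|exact/cvg_lim].
Qed.

(** Real and imaginary parts bring complex products and inverses within reach of the rules for
    real-valued functions. *)
Lemma is_derive_Rc (V : normedModType R) (f : V -> C) (x v : V) (df : C) :
  is_derive x v f df <->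
  is_derive x v (Re \o f : V -> R^o) (Re df) /\ is_derive x v (Im \o f : V -> R^o) (Im df).
Proof.
rewrite !is_derive_cvgP cvg_Rc.
rewrite (_ : _ \o _ = fun h : R => h^-1 *: ((Re \o f) (h *: v + x) - (Re \o f) x : R^o)).
  rewrite (_ : _ \o _ = fun h : R => h^-1 *: ((Im \o f) (h *: v + x) - (Im \o f) x : R^o))//.
  by apply/funext => h; rewrite /= Rc_ImZ Rc_ImD Rc_ImN.
by apply/funext => h; rewrite /= Rc_ReZ Rc_ReD Rc_ReN.
Qed.

Lemma is_derive_RcM (V : normedModType R) (f g : V -> C) (x v : V) (df dg : C) :
  is_derive x v f df -> is_derive x v g dg ->
  is_derive x v (fun y => f y * g y) (df * g x + f x * dg).
Proof.
move=> /is_derive_Rc[fr fi] /is_derive_Rc[gr gi]; apply/is_derive_Rc; split.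
- rewrite (_ : _ \o _ = (Re \o f) * (Re \o g) - (Im \o f) * (Im \o g)); last first.
    by apply/funext => y /=; rewrite Rc_ReM.
  apply: (@is_derive_eq _ _ R^o) => /=.
  by rewrite Rc_ReD !Rc_ReM /GRing.scale/=; ring.
- rewrite (_ : _ \o _ = (Re \o f) * (Im \o g) + (Im \o f) * (Re \o g)); last first.
    by apply/funext => y /=; rewrite Rc_ImM.
  apply: (@is_derive_eq _ _ R^o) => /=.
  by rewrite Rc_ImD !Rc_ImM /GRing.scale/=; ring.
Qed.

Lemma is_derive_Rc_conj (V : normedModType R) (f : V -> C) (x v : V) (df : C) :
  is_derive x v f df -> is_derive x v (fun y => cbar (f y)) (cbar df).
Proof.
move=> /is_derive_Rc[fr fi]; apply/is_derive_Rc; split.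
- rewrite (_ : _ \o _ = Re \o f); last by apply/funext => y /=; case: (f y).
  by case: df fr fi.
- rewrite (_ : _ \o _ = - (Im \o f)); last first.
    by apply/funext => y; rewrite opprfctE /=; case: (f y).
  by case: df fr fi => a b fr /= fi; exact: is_deriveN.
Qed.

Lemma is_derive_ofreal (V : normedModType R) (f : V -> R) (x v : V) (df : R) :
  is_derive x v (f : V -> R^o) df -> is_derive x v (fun y => ofreal (f y)) (ofreal df).
Proof.
by move=> fd; apply/is_derive_Rc; split => //; apply: (is_derive_cst (0 : R^o)).
Qed.

Lemma ofrealD (a b : R) : ofreal (a + b) = ofreal a + ofreal b.
Proof. by apply: eq_Rc; rewrite /= ?addr0. Qed.
Lemma ofrealN (a : R) : ofreal (- a) = - ofreal a.
Proof. by apply: eq_Rc; rewrite /= ?oppr0. Qed.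
Lemma ofrealM (a b : R) : ofreal (a * b) = ofreal a * ofreal b.
Proof. by apply: eq_Rc; rewrite /= ?(mulr0, mul0r, subr0, addr0). Qed.
Lemma ofreal_inj : injective (@ofreal R).
Proof. by move=> a b []. Qed.
Lemma ofrealV (a : R) : ofreal a^-1 = (ofreal a)^-1.
Proof.
have [->|a0] := eqVneq a 0; first by rewrite !invr0.
have oa0 : ofreal a != 0 by apply: contra a0 => /eqP/ofreal_inj ->.
by apply: (mulfI oa0); rewrite mulfV// -ofrealM mulfV.
Qed.
Lemma ofrealX (a : R) n : ofreal (a ^+ n) = ofreal a ^+ n.
Proof. by elim: n => // n IH; rewrite !exprS ofrealM IH. Qed.
Lemma ofreal_nat n : ofreal (n%:R : R) = n%:R.
Proof. by elim: n => // n IH; rewrite -!natr1 ofrealD IH. Qed.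
Lemma cbarD (z w : C) : cbar (z + w) = cbar z + cbar w.
Proof. by case: z w => [a b] [c d]; apply: eq_Rc; rewrite //= opprD. Qed.
Lemma cbarN (z : C) : cbar (- z) = - cbar z.
Proof. by case: z. Qed.
Lemma cbarM (z w : C) : cbar (z * w) = cbar z * cbar w.
Proof. by case: z w => [a b] [c d]; apply: eq_Rc; rewrite /= ?mulrNN// mulrN mulNr opprD. Qed.
Lemma cbarK (z : C) : cbar (cbar z) = z.
Proof. by case: z => a b; apply: eq_Rc; rewrite //= opprK. Qed.
Lemma cbar_ofreal (a : R) : cbar (ofreal a) = ofreal a.
Proof. by apply: eq_Rc; rewrite //= oppr0. Qed.
Lemma cbar_ii : cbar (@ii R) = - ii.
Proof. by apply: eq_Rc; rewrite //= oppr0. Qed.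
Lemma ii2 : (@ii R) * ii = -1.
Proof. by apply: eq_Rc; rewrite /= ?(mulr0, mul0r, mulr1, mul1r, sub0r, oppr0, addr0). Qed.
Lemma cbarX (z : C) n : cbar (z ^+ n) = cbar z ^+ n.
Proof. by elim: n => [|n IH]; rewrite ?expr0 ?(cbar_ofreal 1)// !exprS cbarM IH. Qed.
Lemma cbar_eq0 (z : C) : (cbar z == 0) = (z == 0).
Proof.
by apply/eqP/eqP => [z0|->]; [rewrite -[z]cbarK z0|]; rewrite (cbar_ofreal 0).
Qed.
Lemma cbarV (z : C) : cbar z^-1 = (cbar z)^-1.
Proof.
have [->|z0] := eqVneq z 0; first by rewrite invr0 (cbar_ofreal 0) invr0.
have cz0 : cbar z != 0 by rewrite cbar_eq0.
by apply: (mulfI cz0); rewrite mulfV// -cbarM mulfV// (cbar_ofreal 1).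
Qed.

Lemma mul_cbar (z : C) : z * cbar z = ofreal (Re z ^+ 2 + Im z ^+ 2).
Proof. by case: z => a b; apply: eq_Rc; rewrite /= ?mulrN ?opprK// mulrC addNr. Qed.

Lemma addr_cbar (z : C) : z + cbar z = ofreal (Re z *+ 2).
Proof. by case: z => a b; apply: eq_Rc; rewrite /= ?subrr. Qed.

Lemma is_derive_RcV (V : normedModType R) (f : V -> C) (x v : V) (df : C) :
  is_derive x v f df -> f x != 0 ->
  is_derive x v (fun y => (f y)^-1) (- df / f x ^+ 2).
Proof.
move=> fd f0; have [/= fr fi] := (is_derive_Rc _ _ _ _).1 fd.
pose N := (Re \o f) * (Re \o f) + (Im \o f) * (Im \o f).
have NE y : ofreal (N y) = f y * cbar (f y) by rewrite mul_cbar.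
have Nx0 : N x != 0.
  apply/eqP => N0; have := NE x; rewrite N0 => /esym/eqP.
  by rewrite mulf_eq0 (negbTE f0) cbar_eq0 (negbTE f0).
have Nd : is_derive x v (N : V -> R^o) (Re (df * cbar (f x)) *+ 2).
  apply: (@is_derive_eq _ _ R^o); rewrite /GRing.scale/= Rc_ReM.
  by case: (f x) df {fd fr fi NE N Nx0 f0} => a b [c d] /=; ring.
have Vd : is_derive x v (fun y => (N y)^-1 : R^o) (- (N x) ^- 2 * (Re (df * cbar (f x)) *+ 2)).
  have Nder : derivable (N : V -> R^o) x v by case: Nd.
  split; first exact: (derivableV Nx0 Nder).
  by rewrite (deriveV Nx0 Nder); case: Nd => _ ->.
have invE : (fun y => (f y)^-1) = (fun y => cbar (f y) * ofreal (N y)^-1).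
  apply/funext => y; rewrite ofrealV NE.
  have [->|y0] := eqVneq (f y) 0; first by rewrite mul0r invr0 mulr0.
  by field; rewrite cbar_eq0 y0.
rewrite invE; apply: is_derive_eq.
  exact: (is_derive_RcM (is_derive_Rc_conj fd) (is_derive_ofreal Vd)).
rewrite ofrealM ofrealN !ofrealV ofrealX NE -addr_cbar cbarM cbarK.
by field; rewrite cbar_eq0 f0.
Qed.
End RcomplexTheory.

(** * Smooth functions *)

Section SmoothTheory.
Context {R : realType} {V W : normedModType R}.
Implicit Types (U : set V) (f g : V -> W).

Lemma Cn_ext n U f g : open U -> (forall x, U x -> f x = g x) ->
  Cn n U f -> Cn n U g.
Proof.
move=> oU; elim: n f g => [|n IH] f g fg /=.
  move=> cf x Ux; rewrite /prop_for /continuous_at -(fg x Ux).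
  apply: cvg_trans (cf x Ux); apply: near_eq_cvg.
  by apply: filterS (open_nbhs_nbhs (conj oU Ux)) => y /fg ->.
move=> [df Df]; have nfg x : U x -> \forall y \near x, f y = g y.
  by move=> Ux; apply: filterS (open_nbhs_nbhs (conj oU Ux)) => y /fg ->.
split=> [x v Ux|v]; first by apply: near_eq_derivable (df x v Ux); exact: nfg.
by apply: (IH ('D_v f)) (Df v) => x Ux; apply: near_eq_derive; exact: nfg.
Qed.

Lemma smooth_ext U f g : open U -> (forall x, U x -> f x = g x) ->
  smooth U f -> smooth U g.
Proof. by move=> oU fg sf n; apply: Cn_ext (sf n). Qed.

(** Every clause of [Cn] is a condition at the individual points of the set, on functions defined
    everywhere; hence N need not be open. *)
Lemma smooth_local U f :
  (forall x, U x -> exists N : set V, N x /\ smooth N f) -> smooth U f.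
Proof.
move=> loc n; have {}loc x : U x -> exists N : set V, N x /\ Cn n N f.
  by move=> /loc[N [Nx sf]]; exists N.
elim: n f loc => [|n IH] f loc /=; first by move=> x /loc[N [Nx]]; apply.
split=> [x v /loc[N [Nx [df _]]]|v]; first exact: df.
by apply: IH => x /loc[N [Nx [_ /(_ v) Df]]]; exists N.
Qed.

Lemma smooth_sub U U' f : U' `<=` U -> smooth U f -> smooth U' f.
Proof. by move=> UU' sf; apply: smooth_local => x /UU' Ux; exists U. Qed.

Lemma smooth_cont U f x : smooth U f -> U x -> {for x, continuous f}.
Proof. by move=> sf; exact: (sf 0%N). Qed.

Lemma smooth_derivable U f x v : smooth U f -> U x -> derivable f x v.
Proof. by move=> /(_ 1%N)[df _]; exact: df. Qed.

Lemma smooth_is_derive U f x v : smooth U f -> U x -> is_derive x v f ('D_v f x).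
Proof. by move=> sf Ux; exact/derivableP/(smooth_derivable sf). Qed.

Lemma smooth_derive U f v : smooth U f -> smooth U ('D_v f).
Proof. by move=> sf n; case: (sf n.+1) => _ /(_ v). Qed.

(** A coinduction principle: a class of functions closed under directional derivatives, up to
    equality on U, is smooth as soon as its members are continuous and derivable. It settles the
    induction on the order once for many closure properties. *)
Lemma smooth_coind (S : (V -> W) -> Prop) U : open U ->
  (forall f, S f -> [/\ forall x, U x -> {for x, continuous f},
    forall x v, U x -> derivable f x v &
    forall v, exists2 g, S g & forall x, U x -> g x = 'D_v f x]) ->
  forall f, S f -> smooth U f.
Proof.
move=> oU Sstep f Sf n; elim: n f Sf => [|n IH] f /Sstep[cf df Df] //=.
by split=> // v; have [g /IH Cg gE] := Df v; exact: Cn_ext gE Cg.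
Qed.

Lemma smooth_cst U (c : W) : open U -> smooth U (cst c).
Proof.
move=> oU; apply: (smooth_coind (S := fun f => exists c, f = cst c)) => //; last by exists c.
move=> _ [d ->]; split => [x _|x v _|v]; first exact: cvg_cst.
  exact: derivable_cst.
by exists (cst 0) => [|x _]; [exists 0|rewrite derive_cst].
Qed.

Lemma smoothD U f g : open U -> smooth U f -> smooth U g ->
  smooth U (fun x => f x + g x).
Proof.
move=> oU sf sg.
apply: (smooth_coind (S := fun h => exists f g, [/\ smooth U f, smooth U g & h = fun x => f x + g x])) => //; last by exists f, g.
move=> _ [f1 [g1 [sf1 sg1 ->]]]; split=> [x Ux|x v Ux|v].
- by apply: cvgD; [exact: smooth_cont sf1 Ux|exact: smooth_cont sg1 Ux].
- by apply: derivableD; [exact: smooth_derivable sf1 Ux|exact: smooth_derivable sg1 Ux].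
- exists (fun x => 'D_v f1 x + 'D_v g1 x).
    by exists ('D_v f1), ('D_v g1); split => //; exact: smooth_derive.
  move=> x Ux; rewrite deriveD//; [exact: smooth_derivable sf1 Ux|exact: smooth_derivable sg1 Ux].
Qed.

Lemma is_derive_line f (x v : V) (t : R) (df : W) : is_derive (t *: v + x) v f df ->
  is_derive t 1 (fun s => f (s *: v + x)) df.
Proof.
rewrite !is_derive_cvgP => fd; apply: cvg_trans fd.
rewrite (_ : (fun h : R => _) = (fun h : R =>
  h^-1 *: (f (h *: v + (t *: v + x)) - f (t *: v + x))))//.
apply/funext => h; congr (_ *: (f _ - _)).
by rewrite [h *: 1]mulr1 scalerDl addrA.
Qed.

Lemma continuous_line f (x v : V) (t : R) : {for t *: v + x, continuous f} ->
  {for t, continuous (fun s : R => f (s *: v + x))}.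
Proof.
move=> cf; apply: (@continuous_comp _ _ _ (fun s : R => s *: v + x) f) => //.
by apply: cvgD; [exact: scalel_continuous|exact: cvg_cst].
Qed.
End SmoothTheory.

(** * Symmetry of mixed directional derivatives *)

Section Schwarz.
Context {R : realType}.

Lemma MVT_derivable (F dF : R -> R) (a b : R) : a < b ->
  (forall t, a <= t <= b -> is_derive t 1 F (dF t)) ->
  exists2 c, a < c < b & F b - F a = dF c * (b - a).
Proof.
move=> ab Fd; have [||c cab cE] := @MVT _ F dF a b ab.
- by move=> t; rewrite in_itv /= => /andP[at_ tb]; apply: Fd; rewrite !ltW.
- apply: derivable_within_continuous => t; rewrite in_itv /= => /Fd.
  by case.
- by exists c => //; move: cab; rewrite in_itv.
Qed.

Variable V : normedModType R.
Implicit Types (v w x : V).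

(** The mean value theorem is applied twice: along v to the difference of f across [h *: w], then
    along w to fv. The left side is symmetric in v and w, which [schwarz] exploits. *)
Lemma second_difference (f fv fvw : V -> R) v w x (d h : R) :
  (forall y, `|y - x| < d -> is_derive y v f (fv y)) ->
  (forall y, `|y - x| < d -> is_derive y w fv (fvw y)) ->
  0 < h -> h * (`|v| + `|w|) < d ->
  exists2 y, `|y - x| < d &
  f (h *: v + (h *: w + x)) - f (h *: w + x) - (f (h *: v + x) - f x) =
    fvw y * h ^+ 2.
Proof.
move=> fvE fvwE h0 hd.
have near_x (s t : R) : 0 <= s <= h -> 0 <= t <= h -> `|s *: v + (t *: w + x) - x| < d.
  move=> /andP[s0 sh] /andP[t0 th]; rewrite addrA addrK.
  apply: le_lt_trans hd; rewrite (le_trans (ler_normD _ _))// mulrDr.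
  by rewrite !normrZ !ger0_norm// lerD// ler_wpM2r.
have h00 : 0 <= h <= h by rewrite lexx ltW.
have z0h : (0 : R) <= 0 <= h by rewrite lexx ltW.
have [|s /andP[s0 sh]] := @MVT_derivable
    (fun s => f (s *: v + (h *: w + x)) - f (s *: v + x))
    (fun s => fv (s *: v + (h *: w + x)) - fv (s *: v + x)) 0 h h0.
  move=> t th; apply: (is_deriveB (W := R^o)); apply: (is_derive_line (W := R^o)); apply: fvE.
    exact: near_x.
  by have := near_x t 0 th z0h; rewrite scale0r add0r.
rewrite !scale0r !add0r subr0 => psiE.
have sI : 0 <= s <= h by rewrite !ltW.
have [|t /andP[t0 th]] := @MVT_derivable (fun t => fv (t *: w + (s *: v + x)))
    (fun t => fvw (t *: w + (s *: v + x))) 0 h h0.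
  move=> t th; apply: (is_derive_line (W := R^o)); apply: fvwE.
  by rewrite addrCA; exact: near_x.
rewrite scale0r add0r subr0 => chiE.
exists (t *: w + (s *: v + x)); first by rewrite addrCA near_x// !ltW.
rewrite expr2 mulrA -chiE [h *: w + (s *: v + x)]addrCA -psiE.
by ring.
Qed.

(** The two orders of differencing give the same number, namely h^2 times fvw at one point near x
    and h^2 times fwv at another; continuity at x then brings both values to x. *)
Lemma schwarz (U : set V) (f fv fw fvw fwv : V -> R) v w x : open U -> U x ->
  (forall y, U y -> is_derive y v f (fv y)) ->
  (forall y, U y -> is_derive y w f (fw y)) ->
  (forall y, U y -> is_derive y w fv (fvw y)) ->
  (forall y, U y -> is_derive y v fw (fwv y)) ->
  {for x, continuous fvw} -> {for x, continuous fwv} -> fvw x = fwv x.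
Proof.
move=> oU Ux fvE fwE fvwE fwvE cvw cwv.
apply/eqP; rewrite -subr_eq0 -normr_le0; apply/ler_addgt0Pl => e e0.
have e20 : 0 < e / 2 by rewrite divr_gt0.
have : \forall y \near x, [/\ U y, `|fvw x - fvw y| <= e / 2 & `|fwv x - fwv y| <= e / 2].
  near=> y; split; first by near: y; exact: open_nbhs_nbhs.
    by near: y; move/cvgrPdist_le : cvw; apply.
  by near: y; move/cvgrPdist_le : cwv; apply.
move=> /nbhs_ballP[d /= d0]; rewrite -ball_normE /= => dU.
have {}dU y : `|y - x| < d -> [/\ U y, `|fvw x - fvw y| <= e / 2 & `|fwv x - fwv y| <= e / 2].
  by move=> yx; apply: (dU y); rewrite /ball_ /= distrC.
pose h := d / (2 * (`|v| + `|w| + 1)).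
have vw0 : 0 < `|v| + `|w| + 1 by rewrite ltr_wpDl// addr_ge0.
have h0 : 0 < h by rewrite divr_gt0// mulr_gt0.
have hd : h * (`|v| + `|w|) < d.
  rewrite /h mulrAC ltr_pdivrMr ?mulr_gt0// ltr_pM2l//.
  have : 0 <= `|v| + `|w| by rewrite addr_ge0.
  by lra.
have [||y1 y1x E1] := @second_difference f fv fvw v w x d h _ _ h0 hd.
- by move=> y /dU[Uy _ _]; exact: fvE.
- by move=> y /dU[Uy _ _]; exact: fvwE.
have hd' : h * (`|w| + `|v|) < d by rewrite (addrC `|w|).
have [||y2 y2x E2] := @second_difference f fw fwv w v x d h _ _ h0 hd'.
- by move=> y /dU[Uy _ _]; exact: fwE.
- by move=> y /dU[Uy _ _]; exact: fwvE.
have {E1 E2} E : fvw y1 = fwv y2.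
  have h2 : h ^+ 2 != 0 by rewrite expf_neq0// gt_eqF.
  by apply: (mulIf h2); rewrite -E1 -E2 [h *: w + (h *: v + x)]addrCA; ring.
have [_ A _] := dU y1 y1x; have [_ _ B] := dU y2 y2x.
rewrite addr0 (_ : fvw x - fwv x = (fvw x - fvw y1) - (fwv x - fwv y2)); last first.
  by rewrite E; ring.
by rewrite (le_trans (ler_normB _ _))// [e]splitr lerD.
Unshelve. all: by end_near. Qed.
End Schwarz.

(** * Wirtinger calculus *)

Section Wirtinger.
Context {R : realType}.
Local Notation C := (Rcomplex R).
Local Notation Re := (@complex.Re R : C -> R).
Local Notation Im := (@complex.Im R : C -> R).
Implicit Types (U : set C) (f g : C -> C).

Lemma cvg_RcM (T : Type) (F : set_system T) (FF : Filter F) (f g : T -> C) (a b : C) :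
  f @ F --> a -> g @ F --> b -> (fun x => f x * g x) @ F --> a * b.
Proof.
move=> /cvg_Rc[fr fi] /cvg_Rc[gr gi]; apply/cvg_Rc; rewrite Rc_ReM Rc_ImM; split.
  rewrite (_ : _ \o _ = (Re \o f) * (Re \o g)
    - (Im \o f) * (Im \o g)).
    by apply: cvgB; exact: cvgM.
  by apply/funext => x; rewrite /= Rc_ReM.
rewrite (_ : _ \o _ = (Re \o f) * (Im \o g)
    + (Im \o f) * (Re \o g)).
  by apply: cvgD; exact: cvgM.
by apply/funext => x; rewrite /= Rc_ImM.
Qed.

Lemma smoothM U f g : open U -> smooth U f -> smooth U g ->
  smooth U (fun x => f x * g x).
Proof.
move=> oU sf sg n; elim: n f g sf sg => [|n IH] f g sf sg /=.
  by move=> x Ux; exact: (cvg_RcM _ (smooth_cont sf Ux) (smooth_cont sg Ux)).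
have fgE x v : U x -> is_derive x v (fun x => f x * g x) ('D_v f x * g x + f x * 'D_v g x).
  by move=> Ux; apply: is_derive_RcM; [exact: smooth_is_derive sf Ux|exact: smooth_is_derive sg Ux].
split=> [x v /(fgE x v)[]//|v].
apply: (@Cn_ext _ _ _ _ _ (fun x => 'D_v f x * g x + f x * 'D_v g x)) => //.
  by move=> x /(fgE x v)[].
(* The derivative of a product is a sum of products, so products alone form no class closed under
   derivation. Sums are therefore treated at finite order, where the induction hypothesis on
   products applies. *)
have Cnsum n0 (p q : C -> C) : Cn n0 U p -> Cn n0 U q -> Cn n0 U (fun x => p x + q x).
  elim: n0 p q => [|m IHm] p q /= cp cq.
    by move=> x Ux; exact: (cvgD (cp x Ux) (cq x Ux)).
  case: cp cq => dp Dp [dq Dq]; split=> [x w Ux|w].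
    by apply: derivableD; [exact: dp|exact: dq].
  apply: (@Cn_ext _ _ _ _ _ (fun x => 'D_w p x + 'D_w q x)) => //; last exact: IHm.
  by move=> x Ux; rewrite deriveD//; [exact: dp|exact: dq].
by apply: Cnsum; apply: IH => //; exact: smooth_derive.
Qed.

Lemma smooth_id U : open U -> smooth U (id : C -> C).
Proof.
move=> oU; apply: (smooth_coind (S := fun f => f = id \/ exists c, f = cst c)) => //; last by left.
move=> _ [->|[c ->]]; split => [x _|x v _|v].
- by move=> A; exact.
- exact: derivable_id.
- by exists (cst v) => [|x _]; [right; exists v|rewrite derive_id].
- exact: cst_continuous.
- exact: derivable_cst.
- by exists (cst 0) => [|x _]; [right; exists 0|rewrite derive_cst].
Qed.

Lemma smooth_cbar U f : open U -> smooth U f -> smooth U (fun x => cbar (f x)).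
Proof.
move=> oU sf; apply: (smooth_coind (S := fun h => exists2 f, smooth U f & h = fun x => cbar (f x))) => //; last by exists f.
move=> _ [g sg ->].
have gE x v : U x -> is_derive x v (fun x => cbar (g x)) (cbar ('D_v g x)).
  by move=> Ux; apply: is_derive_Rc_conj; exact: smooth_is_derive sg Ux.
split => [x Ux|x v /(gE x v)[]//|v].
  have [fr fi] := (cvg_Rc _ _ _).1 (smooth_cont sg Ux).
  apply: (cvg_Rc (nbhs_filter x) _ _).2; split.
    rewrite (_ : _ \o _ = Re \o g); last by apply/funext => y /=; case: (g y).
    by case: (g x) fr.
  rewrite (_ : _ \o _ = - (Im \o g)); last by apply/funext => y; rewrite opprfctE /=; case: (g y).
  rewrite (_ : Im (cbar (g x)) = - Im (g x)); last by case: (g x).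
  exact: cvgN.
exists (fun x => cbar ('D_v g x)); last by move=> x /(gE x v)[_ ->].
by exists ('D_v g) => //; exact: smooth_derive.
Qed.

Lemma smooth_ofreal U (f : C -> R) : open U -> smooth U (f : C -> R^o) ->
  smooth U (fun x => ofreal (f x)).
Proof.
move=> oU sf; apply: (smooth_coind (S := fun h => exists2 f : C -> R, smooth U (f : C -> R^o) & h = fun x => ofreal (f x))) => //; last by exists f.
move=> _ [g sg ->].
have gE x v : U x -> is_derive x v (fun x => ofreal (g x)) (ofreal ('D_v (g : C -> R^o) x)).
  by move=> Ux; apply: is_derive_ofreal; exact: smooth_is_derive sg Ux.
split => [x Ux|x v /(gE x v)[]//|v].
  by apply: (cvg_Rc (nbhs_filter x) _ _).2; split; [exact: smooth_cont sg Ux|exact: cst_continuous].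
exists (fun x => ofreal ('D_v (g : C -> R^o) x)); last by move=> x /(gE x v)[_ ->].
by exists ('D_v (g : C -> R^o)) => //; exact: smooth_derive.
Qed.

Lemma smooth_sum U n (F : 'I_n -> C -> C) : open U -> (forall i, smooth U (F i)) ->
  smooth U (fun x => \sum_(i < n) F i x).
Proof.
move=> oU; elim: n F => [|n IH] F sF.
  by rewrite (_ : (fun x => _) = cst 0);
    [exact: smooth_cst|apply/funext => x; rewrite big_ord0].
rewrite (_ : (fun x => _) = fun x => (\sum_(i < n) F (widen_ord (leqnSn n) i) x) + F ord_max x).
  by apply: smoothD => //; apply: IH.
by apply/funext => x; rewrite big_ord_recr.
Qed.

Lemma smoothX U f n : open U -> smooth U f -> smooth U (fun x => f x ^+ n).
Proof.
move=> oU sf; elim: n => [|n IH]; first exact: smooth_cst.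
rewrite (_ : (fun x => _) = fun x => f x * f x ^+ n); first exact: smoothM.
by apply/funext => x; rewrite exprS.
Qed.

Lemma smoothcM U c f : open U -> smooth U f -> smooth U (fun x => c * f x).
Proof. by move=> oU sf; apply: (smoothM (f := cst c)) => //; exact: smooth_cst. Qed.

Lemma smoothN U f : open U -> smooth U f -> smooth U (fun x => - f x).
Proof.
move=> oU sf; rewrite (_ : (fun x => _) = fun x => -1 * f x); first exact: smoothcM.
by apply/funext => x; rewrite mulN1r.
Qed.

Lemma smoothB U f g : open U -> smooth U f -> smooth U g ->
  smooth U (fun x => f x - g x).
Proof. by move=> oU sf sg; apply: smoothD => //; exact: smoothN. Qed.

Lemma smooth_dz U f : open U -> smooth U f -> smooth U (dz f).
Proof.
by move=> oU sf; apply: smoothcM => //; apply: smoothB => //;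
  [|apply: smoothcM => //]; exact: smooth_derive.
Qed.

Lemma smooth_dzbar U f : open U -> smooth U f -> smooth U (dzbar f).
Proof.
by move=> oU sf; apply: smoothcM => //; apply: smoothD => //;
  [|apply: smoothcM => //]; exact: smooth_derive.
Qed.

(* [df = a dz + b dzbar], tested on the directions 1 and i only: [Cn] provides
   directional derivatives, whose linearity in the direction is never needed. *)
Definition is_wirt (z : C) (f : C -> C) (a b : C) : Prop :=
  is_derive z 1 f (a + b) /\ is_derive z ii f (ii * (a - b)).

Lemma two_neq0 : (2 : C) != 0.
Proof. by rewrite -ofreal_nat; apply/eqP => /(@ofreal_inj R)/eqP; rewrite pnatr_eq0. Qed.

Lemma is_wirt_dz z f a b : is_wirt z f a b -> dz f z = a.
Proof.
move=> [[_ d1] [_ d2]]; rewrite /dz d1 d2 mulrA ii2.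
by have := two_neq0 => t0; field.
Qed.

Lemma is_wirt_dzbar z f a b : is_wirt z f a b -> dzbar f z = b.
Proof.
move=> [[_ d1] [_ d2]]; rewrite /dzbar d1 d2 mulrA ii2.
by have := two_neq0 => t0; field.
Qed.

Lemma derive_1E f z : 'D_(1 : C) f z = dz f z + dzbar f z.
Proof. by rewrite /dz /dzbar; have := two_neq0 => t0; field. Qed.

Lemma derive_iiE f z : 'D_ii f z = ii * (dz f z - dzbar f z).
Proof.
rewrite /dz /dzbar; set a := 'D_ii f z; set b := 'D_1 f z.
transitivity (- (ii * ii) * a); first by rewrite ii2 opprK mul1r.
by have := two_neq0 => t0; field.
Qed.

Lemma is_wirtP z f : derivable f z 1 -> derivable f z ii -> is_wirt z f (dz f z) (dzbar f z).
Proof. by move=> d1 d2; split; rewrite -?derive_1E -?derive_iiE; exact/derivableP. Qed.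

Lemma smooth_wirt U f z : smooth U f -> U z -> is_wirt z f (dz f z) (dzbar f z).
Proof. by move=> sf Uz; apply: is_wirtP; exact: smooth_derivable sf Uz. Qed.

Lemma is_wirt_cst z (c : C) : is_wirt z (cst c) 0 0.
Proof. by split; apply: is_derive_eq; rewrite ?subr0 ?addr0 ?mulr0. Qed.

Lemma is_wirt_id z : is_wirt z id 1 0.
Proof. by split; apply: is_derive_eq; rewrite ?subr0 ?addr0 ?mulr1. Qed.

Lemma is_wirtD z f g a b c d : is_wirt z f a b -> is_wirt z g c d ->
  is_wirt z (fun x => f x + g x) (a + c) (b + d).
Proof.
move=> [f1 f2] [g1 g2]; split; apply: is_derive_eq; try exact: is_deriveD.
  by ring.
by ring.
Qed.

Lemma is_wirtM z f g a b c d : is_wirt z f a b -> is_wirt z g c d ->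
  is_wirt z (fun x => f x * g x) (a * g z + f z * c) (b * g z + f z * d).
Proof.
by move=> [f1 f2] [g1 g2]; split; (apply: is_derive_eq; [exact: is_derive_RcM|]); ring.
Qed.

Lemma is_wirt_eq z f a b a' b' : is_wirt z f a' b' -> a' = a -> b' = b -> is_wirt z f a b.
Proof. by move=> + <- <-. Qed.

Lemma is_wirtcM z (k : C) f a b : is_wirt z f a b ->
  is_wirt z (fun x => k * f x) (k * a) (k * b).
Proof.
by move=> fd; apply: is_wirt_eq (is_wirtM (is_wirt_cst z k) fd) _ _; rewrite mul0r add0r.
Qed.

Lemma is_wirtN z f a b : is_wirt z f a b -> is_wirt z (fun x => - f x) (- a) (- b).
Proof.
move=> fd; rewrite -(mulN1r a) -(mulN1r b) (_ : (fun x => _) = fun x => -1 * f x).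
  exact: is_wirtcM.
by apply/funext => x; rewrite mulN1r.
Qed.

Lemma is_wirtB z f g a b c d : is_wirt z f a b -> is_wirt z g c d ->
  is_wirt z (fun x => f x - g x) (a - c) (b - d).
Proof. by move=> fd gd; apply: is_wirtD => //; exact: is_wirtN. Qed.

Lemma is_wirt_conj z f a b : is_wirt z f a b ->
  is_wirt z (fun x => cbar (f x)) (cbar b) (cbar a).
Proof.
move=> [f1 f2]; split; apply: is_derive_eq; try exact: is_derive_Rc_conj.
  by rewrite cbarD addrC.
by rewrite cbarM cbar_ii cbarD cbarN; ring.
Qed.

Lemma is_wirtX z f a b n : is_wirt z f a b ->
  is_wirt z (fun x => f x ^+ n) (n%:R * f z ^+ n.-1 * a) (n%:R * f z ^+ n.-1 * b).
Proof.
move=> fd; elim: n => [|n IH].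
  by rewrite !mul0r; exact: is_wirt_cst.
rewrite (_ : (fun x => _) = fun x => f x * f x ^+ n); last first.
  by apply/funext => x; rewrite exprS.
apply: is_wirt_eq (is_wirtM fd IH) _ _; case: n {IH} => [|n] /=;
  rewrite ?expr0 -?[in RHS]natr1 ?exprS ?mul0r; by ring.
Qed.

Lemma is_wirtV z f a b : is_wirt z f a b -> f z != 0 ->
  is_wirt z (fun x => (f x)^-1) (- a / f z ^+ 2) (- b / f z ^+ 2).
Proof.
by move=> [f1 f2] f0; split; (apply: is_derive_eq; [exact: is_derive_RcV|]); field.
Qed.

Lemma is_wirt_sum z n (F : 'I_n -> C -> C) (a b : 'I_n -> C) :
  (forall i, is_wirt z (F i) (a i) (b i)) ->
  is_wirt z (fun x => \sum_(i < n) F i x) (\sum_(i < n) a i) (\sum_(i < n) b i).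
Proof.
elim: n F a b => [|n IH] F a b Fd.
  rewrite !big_ord0 (_ : (fun x => _) = cst 0); first exact: is_wirt_cst.
  by apply/funext => x; rewrite big_ord0.
rewrite (_ : (fun x => _) = fun x => (\sum_(i < n) F (widen_ord (leqnSn n) i) x) + F ord_max x).
  by rewrite !big_ord_recr; apply: is_wirtD => //; apply: IH.
by apply/funext => x; rewrite big_ord_recr.
Qed.

Section OnOpen.
Variables (U : set C) (oU : open U).

Lemma nearU z : U z -> \forall y \near z, U y.
Proof. by move=> Uz; exact: open_nbhs_nbhs. Qed.

Lemma dz_ext f g z : (forall x, U x -> f x = g x) -> U z -> dz f z = dz g z.
Proof.
move=> fg Uz; have nfg : \forall y \near z, f y = g y.
  by apply: filterS (nearU Uz) => y /fg.
by rewrite /dz !(near_eq_derive _ nfg).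
Qed.

Lemma dzbar_ext f g z : (forall x, U x -> f x = g x) -> U z -> dzbar f z = dzbar g z.
Proof.
move=> fg Uz; have nfg : \forall y \near z, f y = g y.
  by apply: filterS (nearU Uz) => y /fg.
by rewrite /dzbar !(near_eq_derive _ nfg).
Qed.

Lemma iter_dz_ext m f g z : (forall x, U x -> f x = g x) -> U z ->
  iter m dz f z = iter m dz g z.
Proof. by move=> fg; elim: m z => [|m IH] z Uz /=; [exact: fg|exact: dz_ext]. Qed.

Lemma smooth_iter_dz m f : smooth U f -> smooth U (iter m dz f).
Proof. by move=> sf; elim: m => //= m IH; exact: smooth_dz. Qed.

Lemma derive_Re_Im f v z : smooth U f -> U z ->
  is_derive z v (Re \o f : C -> R^o) (Re ('D_v f z)) /\
  is_derive z v (Im \o f : C -> R^o) (Im ('D_v f z)).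
Proof. by move=> sf Uz; apply/is_derive_Rc; exact: smooth_is_derive sf Uz. Qed.

Lemma derive_comm f v w z : smooth U f -> U z -> 'D_w ('D_v f) z = 'D_v ('D_w f) z.
Proof.
move=> sf Uz.
have sv := smooth_derive v sf; have sw := smooth_derive w sf.
have svw := smooth_derive w sv; have swv := smooth_derive v sw.
have [cr1 ci1] := (cvg_Rc _ _ _).1 (smooth_cont svw Uz).
have [cr2 ci2] := (cvg_Rc _ _ _).1 (smooth_cont swv Uz).
have dv y (Uy : U y) := derive_Re_Im v sf Uy.
have dw y (Uy : U y) := derive_Re_Im w sf Uy.
have dvw y (Uy : U y) := derive_Re_Im w sv Uy.
have dwv y (Uy : U y) := derive_Re_Im v sw Uy.
apply: eq_Rc.
  exact: (@schwarz _ _ U (Re \o f) (Re \o 'D_v f) (Re \o 'D_w f)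
    (Re \o 'D_w ('D_v f)) (Re \o 'D_v ('D_w f)) v w z oU Uz
    (fun y Uy => (dv y Uy).1) (fun y Uy => (dw y Uy).1)
    (fun y Uy => (dvw y Uy).1) (fun y Uy => (dwv y Uy).1) cr1 cr2).
exact: (@schwarz _ _ U (Im \o f) (Im \o 'D_v f) (Im \o 'D_w f)
  (Im \o 'D_w ('D_v f)) (Im \o 'D_v ('D_w f)) v w z oU Uz
  (fun y Uy => (dv y Uy).2) (fun y Uy => (dw y Uy).2)
  (fun y Uy => (dvw y Uy).2) (fun y Uy => (dwv y Uy).2) ci1 ci2).
Qed.

Lemma dz_dzbar f z : smooth U f -> U z -> dz (dzbar f) z = dzbar (dz f) z.
Proof.
move=> sf Uz; have s1 := smooth_derive (1 : C) sf; have s2 := smooth_derive ii sf.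
have W1 := smooth_wirt s1 Uz; have W2 := smooth_wirt s2 Uz.
rewrite (is_wirt_dz (is_wirtcM 2^-1 (is_wirtD W1 (is_wirtcM ii W2)))).
rewrite (is_wirt_dzbar (is_wirtcM 2^-1 (is_wirtB W1 (is_wirtcM ii W2)))).
have := derive_comm ii (1 : C) sf Uz; rewrite /dz /dzbar.
move: ('D_1 ('D_1 f) z) ('D_ii ('D_ii f) z) ('D_ii ('D_1 f) z) ('D_1 ('D_ii f) z).
by move=> a b c d ->; ring.
Qed.

End OnOpen.
End Wirtinger.

(** * Iterated Wirtinger derivatives *)

Section IteratedWirtinger.
Context {R : realType}.
Local Notation C := (Rcomplex R).
Local Notation Re := (@complex.Re R : C -> R).
Local Notation Im := (@complex.Im R : C -> R).
Implicit Types (f g : C -> C).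
Variables (U : set C) (oU : open U).

Lemma iter_dzD m (a b : C) f g z : smooth U f -> smooth U g -> U z ->
  iter m dz (fun x => a * f x + b * g x) z = a * iter m dz f z + b * iter m dz g z.
Proof.
move=> sf sg; elim: m z => [//|m IH] z Uz; rewrite !iterS (dz_ext oU IH Uz).
have Wf := smooth_wirt (smooth_iter_dz oU m sf) Uz.
have Wg := smooth_wirt (smooth_iter_dz oU m sg) Uz.
exact: is_wirt_dz (is_wirtD (is_wirtcM a Wf) (is_wirtcM b Wg)).
Qed.

Lemma smooth_iter_dzbar m f : smooth U f -> smooth U (iter m dzbar f).
Proof. by move=> sf; elim: m => //= m IH; exact: smooth_dzbar. Qed.

Lemma iter_dz_conj m f z : smooth U f -> U z ->
  iter m dz (fun x => cbar (f x)) z = cbar (iter m dzbar f z).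
Proof.
move=> sf; elim: m z => [//|m IH] z Uz; rewrite !iterS (dz_ext oU IH Uz).
exact: is_wirt_dz (is_wirt_conj (smooth_wirt (smooth_iter_dzbar m sf) Uz)).
Qed.

Lemma iter_dzbar_dz m f z : smooth U f -> U z ->
  iter m dzbar (dz f) z = dz (iter m dzbar f) z.
Proof.
move=> sf; elim: m z => [//|m IH] z Uz; rewrite !iterS (dzbar_ext oU IH Uz).
by rewrite (dz_dzbar oU (smooth_iter_dzbar m sf) Uz).
Qed.

Lemma iter_dz_dzbar m f z : smooth U f -> U z ->
  iter m dz (dzbar f) z = dzbar (iter m dz f) z.
Proof.
move=> sf; elim: m z => [//|m IH] z Uz; rewrite !iterS (dz_ext oU IH Uz).
by rewrite (dz_dzbar oU (smooth_iter_dz oU m sf) Uz).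
Qed.

Section Nilpotent.
Variables (D : (C -> C) -> C -> C) (al be : C).
Hypothesis DE : forall f z, D f z = al * dz f z + be * dzbar f z.

Lemma wirt_comb_ext f g z : (forall x, U x -> f x = g x) -> U z -> D f z = D g z.
Proof. by move=> fg Uz; rewrite !DE (dz_ext oU fg Uz) (dzbar_ext oU fg Uz). Qed.

Lemma smooth_iterD m f : smooth U f -> smooth U (iter m D f).
Proof.
move=> sf; elim: m => //= m IH.
apply: (@smooth_ext _ _ _ _ (fun z => al * dz (iter m D f) z + be * dzbar (iter m D f) z)) => //.
by apply: smoothD => //; apply: smoothcM => //; [exact: smooth_dz|exact: smooth_dzbar].
Qed.

Lemma iterD_lin m (a b : C) f g z : smooth U f -> smooth U g -> U z ->
  iter m D (fun x => a * f x + b * g x) z = a * iter m D f z + b * iter m D g z.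
Proof.
move=> sf sg; elim: m z => [//|m IH] z Uz; rewrite !iterS (wirt_comb_ext IH Uz).
have Wf := smooth_wirt (smooth_iterD m sf) Uz.
have Wg := smooth_wirt (smooth_iterD m sg) Uz.
have W := is_wirtD (is_wirtcM a Wf) (is_wirtcM b Wg).
by rewrite DE (is_wirt_dz W) (is_wirt_dzbar W) !DE; ring.
Qed.

Lemma iterD0 m f z : (forall x, U x -> f x = 0) -> U z -> iter m D f z = 0.
Proof.
move=> f0; elim: m z => [|m IH] z Uz; first exact: f0.
rewrite iterS (wirt_comb_ext (g := cst 0) IH Uz) DE.
have W := is_wirt_cst z (0 : C).
by rewrite (is_wirt_dz W) (is_wirt_dzbar W) !mulr0 addr0.
Qed.

(** Pigeonhole: a word of m letters with fewer than a letters dz and fewer than b letters dzbar has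
    at most a + b - 2 < m letters. The induction spends the first letter, lowering a or b by one;
    commutation carries the other equation past it. *)
Lemma iterD_eq0 m a b f z : smooth U f -> (a + b <= m.+1)%N ->
  (forall x, U x -> iter a dz f x = 0) -> (forall x, U x -> iter b dzbar f x = 0) ->
  U z -> iter m D f z = 0.
Proof.
elim: m a b f z => [|m IH] [|a] [|b] f z sf abm fa fb Uz; try exact: iterD0; try by [].
  by move: abm; rewrite addnS addSn ltnS ltn0.
rewrite iterSr (_ : D f = fun x => al * dz f x + be * dzbar f x); last first.
  by apply/funext => x; exact: DE.
have sdz := smooth_dz oU sf; have sdzb := smooth_dzbar oU sf.
rewrite iterD_lin//.
have -> : iter m D (dz f) z = 0.
  apply: (IH a b.+1) => //.
    by move=> x Ux; rewrite -iterSr; exact: fa.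
  move=> x Ux; rewrite iter_dzbar_dz// (dz_ext (g := cst 0) oU fb Ux).
  exact: is_wirt_dz (is_wirt_cst x 0).
have -> : iter m D (dzbar f) z = 0.
  apply: (IH a.+1 b) => //; first by move: abm; rewrite addnS ltnS.
    move=> x Ux; rewrite iter_dz_dzbar// (dzbar_ext (g := cst 0) oU fa Ux).
    exact: is_wirt_dzbar (is_wirt_cst x 0).
  by move=> x Ux; rewrite -iterSr; exact: fb.
by rewrite !mulr0 addr0.
Qed.
End Nilpotent.

Definition rr (z : C) : C := z - cbar z.

Lemma is_wirt_rr z : is_wirt z rr 1 (-1).
Proof.
apply: is_wirt_eq (is_wirtB (is_wirt_id z) (is_wirt_conj (is_wirt_id z))) _ _.
  by rewrite (cbar_ofreal 0) subr0.
by rewrite (cbar_ofreal 1) sub0r.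
Qed.

Lemma smooth_rr : smooth U rr.
Proof.
by apply: smoothB => //; [exact: smooth_id|apply: smooth_cbar => //; exact: smooth_id].
Qed.

Lemma iter_dz_rrM m f z : smooth U f -> U z ->
  iter m.+1 dz (fun x => rr x * f x) z =
  rr z * iter m.+1 dz f z + m.+1%:R * iter m dz f z.
Proof.
move=> sf; elim: m z => [|m IH] z Uz.
  by rewrite /= (is_wirt_dz (is_wirtM (is_wirt_rr z) (smooth_wirt sf Uz))); ring.
rewrite iterS (dz_ext oU IH Uz).
have W1 := smooth_wirt (smooth_iter_dz oU m.+1 sf) Uz.
have W0 := smooth_wirt (smooth_iter_dz oU m sf) Uz.
rewrite (is_wirt_dz (is_wirtD (is_wirtM (is_wirt_rr z) W1) (is_wirtcM m.+1%:R W0))).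
by rewrite -!iterS -[m.+2%:R]natr1; ring.
Qed.

(* Bol's identity *)
Lemma deltan_iter_dz m f z : (forall x, U x -> rr x != 0) -> smooth U f -> U z ->
  rr z ^+ m * deltan m.+1 f z = iter m.+1 dz (fun x => rr x ^+ m * f x) z.
Proof.
move=> r0 sf; elim: m z => [|m IH] z Uz.
  rewrite expr0 mul1r /= /delta muln0 mul0r mul0r addr0.
  by apply: (dz_ext oU) => // x _; rewrite expr0 mul1r.
have srf n : smooth U (fun x => rr x ^+ n * f x).
  by apply: smoothM => //; apply: smoothX => //; exact: smooth_rr.
pose H := iter m.+1 dz (fun x => rr x ^+ m * f x).
have sH : smooth U H by exact: smooth_iter_dz.
have dE x : U x -> deltan m.+1 f x = (rr x)^-1 ^+ m * H x.
  move=> Ux; rewrite /H -IH// exprVn mulKf//.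
  by rewrite expf_neq0// r0.
(* The coefficient m + 2 produced here by Leibniz is also what the other side gives: differentiating
   [rr ^- m] contributes -m and the weight contributes 2(m + 1). *)
have HE : iter m.+2 dz (fun x => rr x ^+ m.+1 * f x) z =
    rr z * dz H z + m.+2%:R * H z.
  rewrite -[RHS](iter_dz_rrM m.+1 (srf m) Uz).
  by apply: (iter_dz_ext oU) => // x _; rewrite exprS mulrA.
rewrite HE.
have r0z := r0 z Uz.
have -> : deltan m.+2 f z = dz (deltan m.+1 f) z + (2 * m.+1)%:R / rr z * deltan m.+1 f z by [].
rewrite (dz_ext oU dE Uz) dE//.
rewrite (is_wirt_dz (is_wirtM (is_wirtX m (is_wirtV (is_wirt_rr z) r0z)) (smooth_wirt sH Uz))).
rewrite natrM -[m.+2%:R]natr1 -[m.+1%:R]natr1.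
case: m {IH dE HE sH srf} @H => [|m] H /=; first by rewrite !expr0 expr1; field.
rewrite -[m.+1%:R]natr1 !exprVn !exprS.
have p0 : rr z ^+ m != 0 by rewrite expf_neq0.
by move: (rr z ^+ m) p0 => p p0; field; rewrite p0 r0z.
Qed.
End IteratedWirtinger.

(** * Functions of one real variable with a vanishing iterated derivative *)

Section LinePolynomial.
Context {R : realType}.

Lemma poly_antideriv (q : {poly R}) : exists p : {poly R}, p^`() = q.
Proof.
exists (\poly_(i < (size q).+1) (q`_i.-1 / i%:R)); apply/polyP => i.
rewrite coef_deriv coef_poly ltnS; case: ltnP => [_|qi] /=.
  by rewrite -mulrnAr -(mulr_natr (_^-1)) mulVf ?mulr1// pnatr_eq0.
by rewrite mul0rn nth_default.
Qed.

Lemma zero_deriv_const (J : set R) (F : R -> R) :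
  (forall s t u, J s -> J u -> s <= t <= u -> J t) ->
  (forall t, J t -> is_derive t 1 F 0) -> forall s t, J s -> J t -> F s = F t.
Proof.
move=> cJ Fd; suff lt_cst s t : J s -> J t -> s < t -> F s = F t.
  by move=> s t Js Jt; case: (ltgtP s t) => [||->//] st; [|apply/esym]; exact: lt_cst.
move=> Js Jt st; have [|u _ /eqP] := @MVT_derivable _ F (cst 0) s t st.
  by move=> u sut; apply: Fd; exact: cJ sut.
by rewrite mul0r subr_eq0 => /eqP.
Qed.

(** F lists the successive derivatives, so that the induction can shift the list: if F 1 agrees with
    a polynomial on J, then F 0 minus an antiderivative of it has zero derivative, hence is constant
    on the convex set J. *)
Lemma nilpotent_deriv_poly (J : set R) (F : nat -> R -> R) m :
  (forall s t u, J s -> J u -> s <= t <= u -> J t) ->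
  (forall i t, J t -> is_derive t 1 (F i) (F i.+1 t)) ->
  (forall t, J t -> F m t = 0) ->
  exists q : {poly R}, forall t, J t -> F 0%N t = q.[t].
Proof.
move=> cJ; elim: m F => [|m IH] F Fd F0.
  by exists 0 => t Jt; rewrite F0 ?horner0.
have [q qE] := IH (fun i => F i.+1) (fun i => Fd i.+1) F0.
have [[s Js]|noJ] := pselect (exists s, J s); last first.
  by exists 0 => t Jt; exfalso; apply: noJ; exists t.
have [p pE] := poly_antideriv q.
exists (p + (F 0%N s - p.[s])%:P) => t Jt.
have cst := @zero_deriv_const J (F 0%N - horner p) cJ _ t s Jt Js.
rewrite hornerD hornerC.
suff /cst : forall t, J t -> is_derive t 1 (F 0%N - horner p) 0.
  by move=> /eqP; rewrite subr_eq => /eqP ->; rewrite addrC.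
move=> u Ju; apply: is_derive_eq; first by apply: is_deriveB; exact: Fd.
by rewrite pE qE// subrr.
Qed.
End LinePolynomial.

(** * The invariant pairing *)

Section PolyFacts.

Lemma coef_linear_exp (K : comNzRingType) (a b : K) n i :
  ((a *: 'X + b%:P) ^+ n)`_i = 'C(n, i)%:R * a ^+ i * b ^+ (n - i).
Proof.
rewrite addrC exprDn coef_sum.
rewrite (eq_bigr (fun j : 'I_n.+1 => ('C(n, j)%:R * a ^+ j * b ^+ (n - j)) * (i == j)%:R)).
  case: (ltnP i n.+1) => [ni|ni].
    rewrite (bigD1 (Ordinal ni))//= eqxx mulr1 big1 ?addr0// => j /eqP ji.
    by case: eqP => [ij|_]; rewrite ?mulr0//; case: ji; exact: val_inj.
  rewrite bin_small// !mul0r big1// => j _; case: eqP => [ij|_]; rewrite ?mulr0//.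
  by move: ni; rewrite ij leqNgt ltn_ord.
move=> j _; rewrite coefMn exprZn -polyC_exp mul_polyC !coefZ coefXn.
by rewrite -mulr_natl; ring.
Qed.

Lemma poly_eq_on (K : idomainType) (f : nat -> K) (p q : {poly K}) : injective f ->
  (forall m, p.[f m] = q.[f m]) -> p = q.
Proof.
move=> finj pq; apply/eqP; rewrite -subr_eq0; apply/negPn/negP => nz.
have := @max_poly_roots _ (p - q) [seq f i | i <- iota 0 (size (p - q))] nz.
rewrite size_map size_iota ltnn map_inj_uniq// iota_uniq; move=> /(_ _ isT) H.
suff : false by []. apply: H; apply/allP => _ /mapP[m _ ->].
by rewrite rootE hornerD hornerN pq subrr.
Qed.
End PolyFacts.

Section Pairing.
Context {R : realType}.
Local Notation C := (Rcomplex R).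
Local Notation Re := (@complex.Re R : C -> R).
Local Notation Im := (@complex.Im R : C -> R).
Implicit Types (p q : {poly C}).

Lemma Rc_natr_inj : injective (fun n : nat => n%:R : C).
Proof.
move=> m n /=; rewrite -!ofreal_nat => /(@ofreal_inj R)/eqP.
by rewrite eqr_nat => /eqP.
Qed.

Lemma Rc_natr_eq0 n : ((n%:R : C) == 0) = (n == 0)%N.
Proof. by apply/eqP/eqP => [|->//]; rewrite -[0]/(0%:R) => /Rc_natr_inj. Qed.

Section FixedWeight.
Variable k : nat.
Local Notation n := (2 * k - 2)%N.

Lemma pairingDl p q r : pairing k (p + q) r = pairing k p r + pairing k q r.
Proof. by rewrite /pairing -big_split/=; apply: eq_bigr => i _; rewrite coefD mulrDr !mulrDl. Qed.

Lemma pairingDr p q r : pairing k r (p + q) = pairing k r p + pairing k r q.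
Proof. by rewrite /pairing -big_split/=; apply: eq_bigr => i _; rewrite coefD mulrDr !mulrDl. Qed.

Lemma pairingZl c p r : pairing k (c *: p) r = c * pairing k p r.
Proof. by rewrite /pairing mulr_sumr; apply: eq_bigr => i _; rewrite coefZ; ring. Qed.

Lemma pairingZr c p r : pairing k r (c *: p) = c * pairing k r p.
Proof. by rewrite /pairing mulr_sumr; apply: eq_bigr => i _; rewrite coefZ; ring. Qed.

Lemma pairing_sumr (I : finType) (F : I -> {poly C}) p :
  pairing k p (\sum_i F i) = \sum_i pairing k p (F i).
Proof.
apply: (big_morph (pairing k p)) => [q r|]; first exact: pairingDr.
by rewrite -(scale0r 0) pairingZr mul0r.
Qed.

(** The binary form of degree n attached to p, that is v^n p(u / v) written without division. *)
Definition homog p (u v : C) : C := \sum_(i < n.+1) p`_i * u ^+ i * v ^+ (n - i).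

(** The binomial coefficients of the power cancel those of the pairing: powers of linear forms act
    as a reproducing kernel for binary forms. *)
Lemma pairing_linear_exp p a b :
  pairing k p ((a *: 'X + b%:P) ^+ n) = homog p (- b) a.
Proof.
apply: eq_bigr => i _; have le_in : (i <= n)%N by rewrite -ltnS.
rewrite coef_linear_exp subKn// bin_sub// (exprNn b).
have : 'C(n, i)%:R != 0 :> C by rewrite Rc_natr_eq0 -lt0n bin_gt0.
by move: ('C(n, i)%:R : C) => B B0; field.
Qed.

Lemma pairing_XsubC_exp z q : (size q <= n.+1)%N ->
  pairing k (('X - z%:P) ^+ n) q = q.[z].
Proof.
move=> sq; rewrite (horner_coef_wide _ sq) (reindex_inj rev_ord_inj)/=.
apply: eq_bigr => i _; have le_in : (i <= n)%N by rewrite -ltnS.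
rewrite subSS -['X]scale1r -polyCN coef_linear_exp expr1n (exprNn z).
have : 'C(n, i)%:R != 0 :> C by rewrite Rc_natr_eq0 -lt0n bin_gt0.
(* The degree n is even, so reversing the index leaves the sign unchanged. *)
have -> : (-1) ^+ (n - i) = (-1) ^+ i :> C.
  by rewrite -signr_odd -[RHS]signr_odd oddB// (_ : odd n = false)//; lia.
move: ('C(n, i)%:R : C) => B B0.
have e1 : (-1) ^+ i * (-1) ^+ i = 1 :> C by rewrite -exprMn mulrNN mulr1 expr1n.
transitivity (((-1) ^+ i * (-1) ^+ i) * z ^+ (n - i) * q`_(n - i)); first by field.
by rewrite e1 mul1r mulrC.
Qed.

Definition XsubC_pows (a b : nat) (z w : C) : {poly C} := ('X - z%:P) ^+ a * ('X - w%:P) ^+ b.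

Lemma size_XsubC_pows a b z w : size (XsubC_pows a b z w) = (a + b).+1.
Proof.
rewrite size_proper_mul ?size_exp_XsubC ?addnS//.
by rewrite !lead_coef_exp !lead_coefXsubC !expr1n mulr1 oner_eq0.
Qed.

Lemma homog_expand p al be z w :
  homog p (al * z + be * w) (al + be) =
  \sum_(j < n.+1) 'C(n, j)%:R * al ^+ j * be ^+ (n - j) * pairing k p (XsubC_pows j (n - j) z w).
Proof.
have := pairing_linear_exp p (al + be) (- (al * z + be * w)); rewrite opprK => <-.
have -> : (al + be) *: 'X + (- (al * z + be * w))%:P =
    be *: ('X - w%:P) + al *: ('X - z%:P).
  by rewrite polyCN polyCD !polyCM -!mul_polyC polyCD; ring.
rewrite exprDn pairing_sumr; apply: eq_bigr => j _.
rewrite !exprZn -!mul_polyC -[_ *+ _]mulr_natl.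
rewrite (_ : _ * _ = ('C(n, j)%:R * al ^+ j * be ^+ (n - j)) *: XsubC_pows j (n - j) z w) ?pairingZr//.
by rewrite -mul_polyC !polyCM polyC_natr /XsubC_pows; ring.
Qed.

Lemma homog_horner p (u v : C) : v != 0 -> (size p <= n.+1)%N ->
  homog p u v = v ^+ n * p.[u / v].
Proof.
move=> v0 sp; rewrite (horner_coef_wide _ sp) mulr_sumr; apply: eq_bigr => i _.
have le_in : (i <= n)%N by rewrite -ltnS.
have -> : v ^+ n = v ^+ (n - i) * v ^+ i by rewrite -exprD subnK.
rewrite expr_div_n.
have : v ^+ i != 0 by rewrite expf_neq0.
by move: (v ^+ i) => w w0; field.
Qed.

(** On binary forms the slash operator is a linear substitution; v != 0 lets the left side be
    computed as the value of a polynomial at u / v. *)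
Lemma homog_slash p g (u v : C) : v != 0 ->
  homog (slash k p g) u v =
  homog p ((g 0 0)%:~R * u + (g 0 1)%:~R * v) ((g 1 0)%:~R * u + (g 1 1)%:~R * v).
Proof.
move=> v0; have sl (a b : C) : (size (a *: 'X + b%:P)%R <= 2)%N.
  by rewrite -mul_polyC size_MXaddC; case: ifP => // _; rewrite ltnS size_polyC leq_b1.
rewrite homog_horner//; last first.
  apply: (leq_trans (size_sum _ _ _)); apply/bigmax_leqP => i _.
  have le_in : (i <= n)%N by rewrite -ltnS.
  rewrite (leq_trans (size_scale_leq _ _))// (leq_trans (size_polyMleq _ _))//.
  have se (a b : C) m : (size ((a *: 'X + b%:P) ^+ m)%R <= m.+1)%N.
    apply: leq_trans (size_exp_leq _ _) _; rewrite ltnS.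
    by rewrite -{2}[m]mul1n leq_mul// -subn1 leq_subLR.
  have := leq_add (se (g 0 0)%:~R (g 0 1)%:~R i) (se (g 1 0)%:~R (g 1 1)%:~R (n - i)%N).
  by rewrite addSn addnS subnKC// => H; rewrite -subn1 leq_subLR.
rewrite /slash horner_sum mulr_sumr; apply: eq_bigr => i _.
have le_in : (i <= n)%N by rewrite -ltnS.
rewrite hornerZ hornerM !horner_exp !hornerE.
have -> : v ^+ n = v ^+ i * v ^+ (n - i) by rewrite -exprD subnKC.
have E (a b : C) : a * u + b * v = v * (a * u / v + b) by field.
rewrite /= !E !(exprMn _ v); ring.
Qed.
End FixedWeight.

Lemma det_mx2 (K : comNzRingType) (g : 'M[K]_2) :
  \det g = g 0 0 * g 1 1 - g 0 1 * g 1 0.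
Proof.
rewrite (expand_det_row _ 0) !big_ord_recl big_ord0 addr0 /cofactor !det_mx11 !mxE /=.
rewrite (_ : lift 0 0 = 1); last exact: val_inj.
rewrite (_ : lift 1 0 = 0); last exact: val_inj.
by rewrite /= expr0 expr1; ring.
Qed.

Lemma inv_mx2 (g : 'M[int]_2) : \det g = 1 ->
  [/\ g^-1 0 0 = g 1 1, g^-1 0 1 = - g 0 1, g^-1 1 0 = - g 1 0 & g^-1 1 1 = g 0 0].
Proof.
move=> dg; pose h : 'M[int]_2 := \matrix_(i, j)
  if i == 0 then (if j == 0 then g 1 1 else - g 0 1)
  else (if j == 0 then - g 1 0 else g 0 0).
have ug : g \is a GRing.unit by rewrite -[_ \is a _]/(g \in unitmx) unitmxE dg unitr1.
have hg : h * g = 1.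
  have := dg; rewrite det_mx2 => dg2.
  apply/matrixP => i j; rewrite !mxE !big_ord_recl big_ord0 !mxE /= addr0.
  rewrite (_ : lift ord0 ord0 = 1); last exact: val_inj.
  have E (m : 'I_2) : m = 0 \/ m = 1.
    by case: m => [[|[|//]] lm]; [left|right]; exact: val_inj.
  rewrite (_ : ord0 = 0); last exact: val_inj.
  by case: (E i) => ->; case: (E j) => ->; rewrite /= -?dg2; ring.
have -> : g^-1 = h by rewrite -[h]mulr1 -(divrr ug) mulrA hg mul1r.
by rewrite !mxE.
Qed.

Lemma ofreal_int (m : int) : ofreal (m%:~R : R) = m%:~R.
Proof. by case: m => i; rewrite ?NegzE ?rmorphN /= -?pmulrn ?ofrealN ofreal_nat. Qed.

Lemma cbar_int (m : int) : cbar (m%:~R : C) = m%:~R.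
Proof. by rewrite -ofreal_int cbar_ofreal. Qed.

Lemma rrE (z : C) : z - cbar z = ofreal (Im z *+ 2) * ii.
Proof. by case: z => a b; apply: eq_Rc; rewrite /=; ring. Qed.

Lemma mob_den_neq0 (g : 'M[int]_2) (z : C) : \det g = 1 -> upper z ->
  (g 1 0)%:~R * z + (g 1 1)%:~R != 0 :> C.
Proof.
rewrite det_mx2 => dg uz; apply/eqP => E.
have E' : (g 1 0)%:~R * cbar z + (g 1 1)%:~R = 0 :> C.
  have := congr1 cbar E; rewrite cbarD cbarM !cbar_int => ->.
  exact: (cbar_ofreal 0).
have : (g 1 0)%:~R * (z - cbar z) = 0 :> C.
  by rewrite mulrBr; move/eqP: E; move/eqP: E'; rewrite !addr_eq0 => /eqP -> /eqP ->; rewrite subrr.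
have intr_eq0C (m : int) : m%:~R = 0 :> C -> m = 0.
  by case: m => i; rewrite ?NegzE ?rmorphN /= -?pmulrn => /eqP; rewrite ?oppr_eq0 Rc_natr_eq0 => /eqP // ->.
move=> /eqP; rewrite mulf_eq0 => /orP[/eqP/intr_eq0C c0|/eqP].
  move: E; rewrite c0 mul0r add0r => /intr_eq0C d0.
  by move: dg; rewrite c0 d0 !mulr0 subrr.
by rewrite rrE => /(congr1 Im); rewrite Rc_ImM /= mul0r mulr1 addr0 => /eqP; rewrite mulrn_eq0/= gt_eqF.
Qed.

Lemma mob_sub_cbar (g : 'M[int]_2) (z : C) : \det g = 1 -> upper z ->
  mob g z - cbar (mob g z) = (z - cbar z) /
   (((g 1 0)%:~R * z + (g 1 1)%:~R) * cbar ((g 1 0)%:~R * z + (g 1 1)%:~R)).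
Proof.
move=> dg uz; have j0 := mob_den_neq0 dg uz.
have : cbar ((g 1 0)%:~R * z + (g 1 1)%:~R : C) != 0 by rewrite cbar_eq0.
move: dg; rewrite det_mx2 => /(congr1 (fun x : int => x%:~R : C)).
rewrite rmorphB !rmorphM /= /mob cbarM cbarV !cbarD !cbarM !cbar_int => dg J0.
transitivity (((g 0 0)%:~R * (g 1 1)%:~R - (g 0 1)%:~R * (g 1 0)%:~R : C) * (z - cbar z) / (((g 1 0)%:~R * z + (g 1 1)%:~R) *
   ((g 1 0)%:~R * cbar z + (g 1 1)%:~R))).
  by field; rewrite j0 J0.
by rewrite dg mul1r.
Qed.

Lemma QzE (z : C) m : Qz z ^+ m = ((z - cbar z) ^+ m)^-1 *: XsubC_pows m m z (cbar z).
Proof. by rewrite /Qz /XsubC_pows exprZn exprVn exprMn. Qed.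

(** With j the automorphy factor, the inverse of g sends the vector (w, 1) to (z, 1) / j and (wbar,
    1) to (zbar, 1) / jbar. Putting s (w, 1) + (wbar, 1) into the form of [act k g p] and comparing
    powers of s gives all the pairings at w in terms of those at z. *)
Lemma pairing_act k (g : 'M[int]_2) p z : (0 < k)%N -> \det g = 1 -> upper z ->
  pairing k (act k g p) (Qz (mob g z) ^+ (k - 1)) = pairing k p (Qz z ^+ (k - 1)).
Proof.
move=> k0 dg uz; set w := mob g z; set n := (2 * k - 2)%N.
set j : C := (g 1 0)%:~R * z + (g 1 1)%:~R.
have j0 : j != 0 by exact: mob_den_neq0.
have J0 : cbar j != 0 by rewrite cbar_eq0.
have [h00 h01 h10 h11] := inv_mx2 dg.
pose c q x i := 'C(n, i)%:R * pairing k q (XsubC_pows i (n - i) x (cbar x)).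
have key : \poly_(i < n.+1) c (act k g p) w i =
    \poly_(i < n.+1) (c p z i * j^-1 ^+ i * (cbar j)^-1 ^+ (n - i)).
  (* Natural numbers are enough values of s, and they keep s + 1 nonzero, as [homog_slash]
     requires. *)
  apply: (@poly_eq_on _ (fun m => m%:R)); first exact: Rc_natr_inj.
  move=> m; set s : C := m%:R; rewrite !horner_poly.
  transitivity (homog k (act k g p) (s * w + 1 * cbar w) (s + 1)).
    rewrite homog_expand; apply: eq_bigr => i _; rewrite /c expr1n; ring.
  have s1 : s + 1 != 0 by rewrite natr1 Rc_natr_eq0.
  rewrite /act homog_slash// h00 h01 h10 h11.
  transitivity (homog k p (s / j * z + (cbar j)^-1 * cbar z) (s / j + (cbar j)^-1)).
    have := dg; rewrite det_mx2 => /(congr1 (fun x : int => x%:~R : C)).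
    rewrite rmorphB !rmorphM /= => dg'.
    have Jd : cbar j = (g 1 0)%:~R * cbar z + (g 1 1)%:~R by rewrite cbarD cbarM !cbar_int.
    have cw : cbar w = ((g 0 0)%:~R * cbar z + (g 0 1)%:~R) / cbar j.
      by rewrite /w /mob cbarM cbarV cbarD cbarM !cbar_int.
    have wE : w = ((g 0 0)%:~R * z + (g 0 1)%:~R) / j by [].
    have aux (g1 g2 g3 g4 x : C) : g1 * g4 - g2 * g3 = 1 -> g3 * x + g4 != 0 ->
        (g4 * ((g1 * x + g2) / (g3 * x + g4)) - g2 = x / (g3 * x + g4)) /\
        (- g3 * ((g1 * x + g2) / (g3 * x + g4)) + g1 = (g3 * x + g4)^-1).
      move=> D X0; split.
        transitivity ((g1 * g4 - g2 * g3) * x / (g3 * x + g4)); first by field.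
        by rewrite D mul1r.
      transitivity ((g1 * g4 - g2 * g3) / (g3 * x + g4)); first by field.
      by rewrite D mul1r.
    have [A1 A2] := aux _ _ _ _ _ dg' j0.
    have J0' := J0; rewrite Jd in J0'.
    have [B1 B2] := aux _ _ _ _ _ dg' J0'.
    rewrite -/j -wE in A1 A2; rewrite -Jd -cw in B1 B2.
    rewrite !rmorphN /=; congr (homog k p _ _).
      transitivity (s * ((g 1 1)%:~R * w - (g 0 1)%:~R) + ((g 1 1)%:~R * cbar w - (g 0 1)%:~R)).
        by ring.
      by rewrite A1 B1; ring.
    transitivity (s * (- (g 1 0)%:~R * w + (g 0 0)%:~R) + (- (g 1 0)%:~R * cbar w + (g 0 0)%:~R)).
      by ring.
    by rewrite A2 B2.
  rewrite homog_expand; apply: eq_bigr => i _; rewrite /c exprMn; ring.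
(* The middle coefficient is the wanted one. Its factor (j jbar)^-(k-1) cancels against the
   transformation of z - zbar in the denominator of [Qz]. *)
have nk : (n - (k - 1) = k - 1)%N by rewrite /n; lia.
have := congr1 (fun P : {poly C} => P`_(k - 1)) key; rewrite !coef_poly.
have -> : (k - 1 < n.+1)%N by rewrite /n; lia.
rewrite /c nk -!mulrA => /mulfI => /(_ _)E.
rewrite !QzE !pairingZr {}E ?Rc_natr_eq0 -?lt0n ?bin_gt0; last by rewrite /n; lia.
rewrite /w mob_sub_cbar// -/j !exprVn exprMn exprVn invfM exprMn invrK.
have : j ^+ (k - 1) != 0 by rewrite expf_neq0.
have : cbar j ^+ (k - 1) != 0 by rewrite expf_neq0.
have r0 : (z - cbar z) ^+ (k - 1) != 0.
  rewrite expf_neq0// rrE; apply/eqP => /(congr1 Im).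
  by rewrite Rc_ImM /= mul0r mulr1 addr0 => /eqP; rewrite mulrn_eq0/= gt_eqF.
move: (j ^+ _) (cbar j ^+ _) r0; move: ((z - cbar z) ^+ _) => a b c' a0 c0 b0.
by field; rewrite a0 b0 c0.
Qed.
End Pairing.

(** * Derivatives of pairings *)

Section RealCoefficients.
Context {R : realType}.
Local Notation C := (Rcomplex R).
Local Notation Re := (@complex.Re R : C -> R).
Local Notation Im := (@complex.Im R : C -> R).

Lemma Im_sum (I : finType) (F : I -> C) : Im (\sum_i F i) = \sum_i Im (F i).
Proof. by apply: (big_morph Im) => // z w; rewrite Rc_ImD. Qed.

Lemma Im0M (z w : C) : Im z = 0 -> Im w = 0 -> Im (z * w) = 0.
Proof. by move=> z0 w0; rewrite Rc_ImM z0 w0 mulr0 mul0r addr0. Qed.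

Lemma Im0_real (z : C) : Im z = 0 -> z = ofreal (Re z).
Proof. by case: z => a b /= ->. Qed.

Lemma real_polyM (p q : {poly C}) : (forall i, Im p`_i = 0) -> (forall i, Im q`_i = 0) ->
  forall i, Im (p * q)`_i = 0.
Proof. by move=> p0 q0 i; rewrite coefM Im_sum big1// => j _; exact: Im0M. Qed.

Lemma real_polyX (p : {poly C}) m : (forall i, Im p`_i = 0) -> forall i, Im (p ^+ m)`_i = 0.
Proof.
move=> p0; elim: m => [|m IH] i; first by rewrite expr0 coef1; case: eqP.
by rewrite exprS; exact: real_polyM.
Qed.

Lemma real_XsubC_pows m (z : C) i : Im (XsubC_pows m m z (cbar z))`_i = 0.
Proof.
rewrite /XsubC_pows -exprMn; apply: real_polyX => {}i.
have -> : ('X - z%:P) * ('X - (cbar z)%:P) =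
    'X * 'X - (ofreal (Re z *+ 2))%:P * 'X + (ofreal (Re z ^+ 2 + Im z ^+ 2))%:P.
  by rewrite -mul_cbar -addr_cbar polyCD polyCM; ring.
rewrite coefD coefB coefCM coefC -expr2 coefXn coefX !Rc_ImD Rc_ImN.
by case: (i == 2)%N; case: (i == 1)%N; case: (i == 0)%N; rewrite /= ?mulr1 ?mulr0 ?oppr0 ?addr0 ?add0r ?oppr0.
Qed.

Lemma Im_pairing_real k (p q : {poly C}) : (forall i, Im p`_i = 0) -> (forall i, Im q`_i = 0) ->
  Im (pairing k p q) = 0.
Proof.
move=> p0 q0; rewrite /pairing Im_sum big1// => i _.
have -> : (-1) ^+ i * p`_i * q`_(2 * k - 2 - i) / 'C(2 * k - 2, i)%:R =
    ofreal ((-1) ^+ i / 'C(2 * k - 2, i)%:R) * (p`_i * q`_(2 * k - 2 - i)).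
  rewrite ofrealM ofrealX ofrealV ofreal_nat ofrealN.
  by rewrite -[ofreal 1]/(1 : C); ring.
by apply: Im0M => //; exact: Im0M.
Qed.

Lemma rr_neq0 (z : C) : upper z -> rr z != 0.
Proof.
move=> uz; rewrite /rr rrE; apply/eqP => /(congr1 Im).
by rewrite Rc_ImM /= mul0r mulr1 addr0 => /eqP; rewrite mulrn_eq0/= gt_eqF.
Qed.

(** The denominator of [Qz z ^+ (k - 1)] is (2 i y)^(k-1) and its numerator is a real polynomial; so
    pairing it with i^k times a real polynomial gives i times a real number. *)
Lemma Re_pairing_coset k (p q r : {poly C}) z : (0 < k)%N -> upper z ->
  coset_iR k r p -> coset_iR k r q ->
  Re (pairing k p (Qz z ^+ (k - 1))) = Re (pairing k q (Qz z ^+ (k - 1))).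
Proof.
move=> k0 uz; suff H s : VpolyR k s -> Re (pairing k (ii ^+ k *: s) (Qz z ^+ (k - 1))) = 0.
  by move=> [s /H s0 <-] [t /H t0 <-]; rewrite !pairingDl !Rc_ReD s0 t0.
move=> [_ sr]; rewrite pairingZl QzE pairingZr.
rewrite (Im0_real (Im_pairing_real k sr (@real_XsubC_pows (k - 1) z))) mulrA.
have -> : ii ^+ k * ((z - cbar z) ^+ (k - 1))^-1 = ofreal ((Im z *+ 2) ^+ (k - 1))^-1 * ii.
  have kE : ii ^+ k = ii * ii ^+ (k - 1) :> C by rewrite -exprS; congr (_ ^+ _); lia.
  rewrite rrE kE exprMn ofrealV ofrealX.
  have i0 : ii ^+ (k - 1) != 0 :> C.
    by rewrite expf_neq0//; apply/eqP => /(congr1 Im) /eqP; rewrite /= oner_eq0.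
  have y0 : ofreal (Im z *+ 2) ^+ (k - 1) != 0.
    rewrite expf_neq0//; apply/eqP => /(@ofreal_inj R)/eqP.
    by rewrite mulrn_eq0/= gt_eqF.
  by move: (ii ^+ _) (ofreal _ ^+ _) i0 y0 => a b a0 b0; field; rewrite a0 b0.
by rewrite !(Rc_ReM, Rc_ImM) /=; ring.
Qed.
End RealCoefficients.

(** * Wirtinger derivatives of polynomial-valued functions, coefficient by coefficient *)

Section PolyWirtinger.
Context {R : realType}.
Local Notation C := (Rcomplex R).
Local Notation Re := (@complex.Re R : C -> R).
Local Notation Im := (@complex.Im R : C -> R).
Implicit Types (P Q : C -> {poly C}) (A B : {poly C}).

Definition is_wirt_poly z P A B := forall i, is_wirt z (fun x => (P x)`_i) A`_i B`_i.

Definition smooth_poly (U : set C) P := forall i, smooth U (fun x => (P x)`_i).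

Lemma is_wirt_polyM z P Q A B A' B' : is_wirt_poly z P A B -> is_wirt_poly z Q A' B' ->
  is_wirt_poly z (fun x => P x * Q x) (A * Q z + P z * A') (B * Q z + P z * B').
Proof.
move=> HP HQ i; rewrite (_ : (fun x => _) = fun x => \sum_(j < i.+1) (P x)`_j * (Q x)`_(i - j)).
  rewrite !coefD !coefM -!big_split /=.
  by apply: is_wirt_sum => j; exact: is_wirtM.
by apply/funext => x; rewrite coefM.
Qed.

Lemma smooth_polyM U P Q : open U -> smooth_poly U P -> smooth_poly U Q ->
  smooth_poly U (fun x => P x * Q x).
Proof.
move=> oU HP HQ i; rewrite (_ : (fun x => _) = fun x => \sum_(j < i.+1) (P x)`_j * (Q x)`_(i - j)).
  by apply: smooth_sum => // j; exact: smoothM.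
by apply/funext => x; rewrite coefM.
Qed.

Lemma is_wirt_polyX z P A B m : is_wirt_poly z P A B ->
  is_wirt_poly z (fun x => P x ^+ m) (m%:R * (P z ^+ m.-1 * A)) (m%:R * (P z ^+ m.-1 * B)).
Proof.
move=> HP; elim: m => [|m IH].
  move=> i; rewrite !mul0r (_ : (fun x => _) = cst (1 : {poly C})`_i); last first.
    by apply/funext => x; rewrite expr0.
  by apply: is_wirt_eq (is_wirt_cst z _) _ _; rewrite (coef0 _ i).
rewrite (_ : (fun x => _) = fun x => P x * P x ^+ m); last first.
  by apply/funext => x; rewrite exprS.
suff E (D : {poly C}) : m.+1%:R * (P z ^+ m.+1.-1 * D) = D * P z ^+ m + P z * (m%:R * (P z ^+ m.-1 * D)).
  by rewrite !E; exact: is_wirt_polyM.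
by case: m {IH} => [|m] /=; rewrite -?[in LHS]natr1 ?expr0 ?exprS; ring.
Qed.

Lemma smooth_polyX U P m : open U -> smooth_poly U P -> smooth_poly U (fun x => P x ^+ m).
Proof.
move=> oU HP; elim: m => [|m IH].
  move=> i; rewrite (_ : (fun x => _) = cst (1 : {poly C})`_i); first exact: smooth_cst.
  by apply/funext => x; rewrite expr0.
rewrite (_ : (fun x => _) = fun x => P x * P x ^+ m); first exact: smooth_polyM.
by apply/funext => x; rewrite exprS.
Qed.

Lemma is_wirt_XsubC z f a b : is_wirt z f a b ->
  is_wirt_poly z (fun x => 'X - (f x)%:P) (- a%:P) (- b%:P).
Proof.
move=> fd i; rewrite (_ : (fun x => _) = fun x => 'X`_i - (i == 0)%:R * f x); last first.
  by apply/funext => x; rewrite coefB coefC; case: (i == 0); rewrite ?mul1r ?mul0r.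
apply: is_wirt_eq (is_wirtB (is_wirt_cst z _) (is_wirtcM _ fd)) _ _;
  by rewrite coefN coefC sub0r; case: (i == 0); rewrite ?mul1r ?mul0r.
Qed.

Lemma smooth_XsubC (U : set C) (f : C -> C) : open U -> smooth U f -> smooth_poly U (fun x => 'X - (f x)%:P).
Proof.
move=> oU sf i; rewrite (_ : (fun x => _) = fun x => 'X`_i - (i == 0)%:R * f x).
  by apply: smoothB => //; [exact: smooth_cst|exact: smoothcM].
by apply/funext => x; rewrite coefB coefC; case: (i == 0); rewrite ?mul1r ?mul0r.
Qed.

(** When a or b is 0 the truncated predecessor is harmless, since it comes with the factor 0. *)
Lemma is_wirt_XsubC_pows a b z : is_wirt_poly z (fun x => XsubC_pows a b x (cbar x))
  (- (a%:R *: XsubC_pows a.-1 b z (cbar z))) (- (b%:R *: XsubC_pows a b.-1 z (cbar z))).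
Proof.
have H1 := is_wirt_polyX a (is_wirt_XsubC (is_wirt_id z)).
have H2 := is_wirt_polyX b (is_wirt_XsubC (is_wirt_conj (is_wirt_id z))).
rewrite (_ : - (a%:R *: _) = a%:R * (('X - (id z)%:P) ^+ a.-1 * (- 1%:P)) * ('X - (cbar z)%:P) ^+ b +
   ('X - (id z)%:P) ^+ a * (b%:R * (('X - (cbar z)%:P) ^+ b.-1 * (- (cbar 0)%:P)))).
  rewrite (_ : - (b%:R *: _) = a%:R * (('X - (id z)%:P) ^+ a.-1 * (- 0%:P)) * ('X - (cbar z)%:P) ^+ b +
   ('X - (id z)%:P) ^+ a * (b%:R * (('X - (cbar z)%:P) ^+ b.-1 * (- (cbar 1)%:P)))).
    exact: (is_wirt_polyM H1 H2).
  by rewrite (cbar_ofreal 1) -[ofreal 1]/(1 : C) -mul_polyC polyC_natr /XsubC_pows; ring.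
by rewrite (cbar_ofreal 0) -[ofreal 0]/(0 : C) -mul_polyC polyC_natr /XsubC_pows; ring.
Qed.

Lemma smooth_XsubC_pows U a b : open U -> smooth_poly U (fun x => XsubC_pows a b x (cbar x)).
Proof.
move=> oU; apply: smooth_polyM => //; apply: smooth_polyX => //; apply: smooth_XsubC => //.
  exact: smooth_id.
by apply: smooth_cbar => //; exact: smooth_id.
Qed.

Lemma is_wirt_pairing k z P Q A B A' B' : is_wirt_poly z P A B -> is_wirt_poly z Q A' B' ->
  is_wirt z (fun x => pairing k (P x) (Q x))
    (pairing k A (Q z) + pairing k (P z) A') (pairing k B (Q z) + pairing k (P z) B').
Proof.
move=> HP HQ.
rewrite (_ : (fun x => _) = fun x => \sum_(i < (2 * k - 2).+1) ((-1) ^+ i / 'C(2 * k - 2, i)%:R) *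
   ((P x)`_i * (Q x)`_(2 * k - 2 - i))); last first.
  by apply/funext => x; apply: eq_bigr => i _; ring.
have E p q p' q' : pairing k p q + pairing k p' q' = \sum_(i < (2 * k - 2).+1) ((-1) ^+ i / 'C(2 * k - 2, i)%:R) *
   (p`_i * q`_(2 * k - 2 - i) + p'`_i * q'`_(2 * k - 2 - i)).
  by rewrite /pairing -big_split; apply: eq_bigr => i _ /=; ring.
by rewrite !E; apply: is_wirt_sum => i; apply: is_wirtcM; exact: is_wirtM.
Qed.

Lemma smooth_pairing U k P Q : open U -> smooth_poly U P -> smooth_poly U Q ->
  smooth U (fun x => pairing k (P x) (Q x)).
Proof.
move=> oU HP HQ.
rewrite (_ : (fun x => _) = fun x => \sum_(i < (2 * k - 2).+1) ((-1) ^+ i / 'C(2 * k - 2, i)%:R) *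
   ((P x)`_i * (Q x)`_(2 * k - 2 - i))).
  by apply: smooth_sum => // i; apply: smoothcM => //; exact: smoothM.
by apply/funext => x; apply: eq_bigr => i _; ring.
Qed.
End PolyWirtinger.

(** * Local differential equations *)

(* [ring] would compare these atoms up to conversion, unfolding limits. *)
Ltac derivative_ring := repeat match goal with
  | |- context [@dz ?R ?f ?z] => let a := fresh "a" in move: (@dz R f z) => a
  | |- context [@dzbar ?R ?f ?z] => let a := fresh "a" in move: (@dzbar R f z) => a
  end; ring.

Section LocalEquations.
Context {R : realType}.
Local Notation C := (Rcomplex R).
Local Notation Re := (@complex.Re R : C -> R).
Local Notation Im := (@complex.Im R : C -> R).
Implicit Types f : C -> C.
Variables (K : nat) (N : set C).
Hypotheses (K0 : (0 < K)%N) (oN : open N) (N_upper : N `<=` upper).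
Local Notation k := K.+1.
Local Notation n := (2 * k - 2)%N.

(* On [rr ^+ K * f] this takes the value [rr ^+ K.-1 * (laplacian f - k (1 - k) f)]. *)
Definition euler_darboux (f : C -> C) (z : C) : C :=
  rr z * dz (dzbar f) z + K%:R * (dz f z - dzbar f z).

Lemma euler_darboux_ext f g z : (forall x, N x -> f x = g x) -> N z ->
  euler_darboux f z = euler_darboux g z.
Proof.
move=> fg Nz; rewrite /euler_darboux (dz_ext oN fg Nz) (dzbar_ext oN fg Nz).
by rewrite (dz_ext oN (fun x Nx => dzbar_ext oN fg Nx) Nz).
Qed.

Lemma euler_darboux_lin (a b : C) f g z : smooth N f -> smooth N g -> N z ->
  euler_darboux (fun x => a * f x + b * g x) z = a * euler_darboux f z + b * euler_darboux g z.
Proof.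
move=> sf sg Nz; have W x (Nx : N x) :=
  is_wirtD (is_wirtcM a (smooth_wirt sf Nx)) (is_wirtcM b (smooth_wirt sg Nx)).
rewrite /euler_darboux (is_wirt_dz (W z Nz)) (is_wirt_dzbar (W z Nz)).
rewrite (dz_ext oN (fun x Nx => is_wirt_dzbar (W x Nx)) Nz).
have W1 := smooth_wirt (smooth_dzbar oN sf) Nz; have W2 := smooth_wirt (smooth_dzbar oN sg) Nz.
by rewrite (is_wirt_dz (is_wirtD (is_wirtcM a W1) (is_wirtcM b W2))); derivative_ring.
Qed.

Lemma cbar_rr (z : C) : cbar (rr z) = - rr z.
Proof. by rewrite /rr cbarD cbarN cbarK opprB addrC. Qed.

(** Conjugation exchanges dz and dzbar and negates [rr], so both terms of the operator change
    sign. *)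
Lemma euler_darboux_conj f z : smooth N f -> N z ->
  euler_darboux (fun x => cbar (f x)) z = - cbar (euler_darboux f z).
Proof.
move=> sf Nz; have W x (Nx : N x) := is_wirt_conj (smooth_wirt sf Nx).
rewrite /euler_darboux (is_wirt_dz (W z Nz)) (is_wirt_dzbar (W z Nz)).
rewrite (dz_ext oN (fun x Nx => is_wirt_dzbar (W x Nx)) Nz).
rewrite (is_wirt_dz (is_wirt_conj (smooth_wirt (smooth_dz oN sf) Nz))) -(dz_dzbar oN sf Nz).
rewrite cbarD (cbarM (rr z)) (cbarM K%:R) cbar_rr (cbarD (dz f z)) (cbarN (dzbar f z)).
have -> : cbar (K%:R : C) = K%:R by rewrite -ofreal_nat cbar_ofreal.
move: (cbar _) (cbar _) (cbar _) => a b e; ring.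
Qed.

(** The constant K in the operator is the one for which the first-order terms in f cancel. *)
Lemma euler_darboux_rrX f z : smooth N f -> N z ->
  euler_darboux (fun x => rr x ^+ K * f x) z =
  rr z ^+ K.-1 * (k%:R * K%:R * f z + rr z ^+ 2 * dz (dzbar f) z).
Proof.
move=> sf Nz; have W x (Nx : N x) := is_wirtM (is_wirtX K (is_wirt_rr x)) (smooth_wirt sf Nx).
rewrite /euler_darboux (is_wirt_dz (W z Nz)) (is_wirt_dzbar (W z Nz)).
rewrite (dz_ext oN (fun x Nx => is_wirt_dzbar (W x Nx)) Nz).
have W1 := is_wirtcM K%:R (is_wirtX K.-1 (is_wirt_rr z)).
have W2 := is_wirtM (is_wirtM W1 (is_wirt_cst z (-1))) (smooth_wirt sf Nz).
have W3 := is_wirtM (is_wirtX K (is_wirt_rr z)) (smooth_wirt (smooth_dzbar oN sf) Nz).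
rewrite (is_wirt_dz (is_wirtD W2 W3)).
case: K K0 => // m _; rewrite -[m.+2%:R]natr1 -[m.+1%:R]natr1 /= exprS.
(* The exponent K - 2 occurs; at K = 1 it is truncated, but its coefficient is 0. *)
case: m => [|m] /=; first by rewrite !expr0; derivative_ring.
by rewrite exprS -[m.+1%:R]natr1; derivative_ring.
Qed.

Section Primitive.
Variables (g : C -> C) (h : C -> {poly C}).
Hypothesis hprim : primitive_on k N (omega k g) h.

Lemma smooth_poly_prim : smooth_poly N h.
Proof. by case: hprim. Qed.

Lemma is_wirt_prim z : N z -> is_wirt_poly z h (omega k g z) 0.
Proof.
case: hprim => _ sh dh Nz i.
apply: is_wirt_eq (smooth_wirt (sh i) Nz) _ _; rewrite /dz /dzbar !dh// !coefZ mul1r.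
  by rewrite (mulrA ii) ii2; have := @two_neq0 R => t0; field.
by rewrite (mulrA ii) ii2 coef0; have := @two_neq0 R => t0; field.
Qed.

(** For a = b = K this is r^K times the pairing of the theorem; smaller exponents arise by
    differentiation. *)
Definition Phi (a b : nat) (z : C) : C := pairing k (h z) (XsubC_pows a b z (cbar z)).

Lemma smooth_Phi a b : smooth N (Phi a b).
Proof. by apply: smooth_pairing => //; [exact: smooth_poly_prim|exact: smooth_XsubC_pows]. Qed.

(** By the reproducing property, differentiating h contributes g times the value at z of the second
    argument, which is 0 unless a = 0. Nothing comes from dzbar h, since dh is a multiple of
    dtau. *)
Lemma is_wirt_Phi a b z : N z -> (a + b <= n)%N ->
  is_wirt z (Phi a b) (g z * (XsubC_pows a b z (cbar z)).[z] - a%:R * Phi a.-1 b z)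
    (- (b%:R * Phi a b.-1 z)).
Proof.
move=> Nz abn; apply: is_wirt_eq (is_wirt_pairing k (is_wirt_prim Nz) (is_wirt_XsubC_pows a b z)) _ _.
  rewrite /omega pairingZl pairing_XsubC_exp ?size_XsubC_pows//.
  by rewrite -scaleNr pairingZr /Phi mulNr.
by rewrite -scaleNr pairingZr -(scale0r (h z)) pairingZl mul0r add0r /Phi mulNr.
Qed.

Lemma XsubC_pows_diag_horner a b (z : C) : (XsubC_pows a.+1 b z (cbar z)).[z] = 0.
Proof. by rewrite /XsubC_pows hornerM horner_exp hornerXsubC subrr expr0n mul0r. Qed.

Lemma iter_dz_Phi m z : (m <= K)%N -> N z ->
  iter m dz (Phi K K) z = (-1) ^+ m * (K ^_ m)%:R * Phi (K - m) K z.
Proof.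
elim: m z => [|m IH] z mK Nz; first by rewrite /= ffactn0 expr0 !mul1r subn0.
rewrite iterS (dz_ext oN (fun x Nx => IH x (ltnW mK) Nx) Nz).
rewrite (is_wirt_dz (is_wirtcM _ (is_wirt_Phi Nz _))); last by lia.
have -> : (K - m = (K - m.+1).+1)%N by lia.
rewrite XsubC_pows_diag_horner ffactnSr natrM (_ : (K - m = (K - m.+1).+1)%N); last by lia.
by rewrite /= exprS; ring.
Qed.

(** After K steps the power of X - z is used up. The next derivative therefore sees h for the first
    time, through (zbar-part at z) = r^K, while the other term carries the factor 0. *)
Lemma iter_dz_Phi_top z : N z ->
  iter k dz (Phi K K) z = (-1) ^+ K * K`!%:R * (g z * rr z ^+ K).
Proof.
move=> Nz; rewrite iterS (dz_ext oN (fun x Nx => iter_dz_Phi (leqnn K) Nx) Nz).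
rewrite (is_wirt_dz (is_wirtcM _ (is_wirt_Phi Nz _))); last by lia.
rewrite subnn ffactnn mul0r subr0 /XsubC_pows expr0 mul1r horner_exp hornerXsubC.
by [].
Qed.

Lemma iter_dzbar_Phi_top z : N z -> iter k dzbar (Phi K K) z = 0.
Proof.
have H m x : (m <= K)%N -> N x ->
    iter m dzbar (Phi K K) x = (-1) ^+ m * (K ^_ m)%:R * Phi K (K - m) x.
  elim: m x => [|m IH] x mK Nx; first by rewrite /= ffactn0 expr0 !mul1r subn0.
  rewrite iterS (dzbar_ext oN (fun x Nx => IH x (ltnW mK) Nx) Nx).
  rewrite (is_wirt_dzbar (is_wirtcM _ (is_wirt_Phi Nx _))); last by lia.
  rewrite ffactnSr natrM (_ : (K - m = (K - m.+1).+1)%N); last by lia.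
  by rewrite /= exprS; ring.
move=> Nz; rewrite iterS (dzbar_ext oN (fun x Nx => H K x (leqnn K) Nx) Nz).
rewrite (is_wirt_dzbar (is_wirtcM _ (is_wirt_Phi Nz _))); last by lia.
by rewrite subnn mul0r oppr0 mulr0.
Qed.

Lemma euler_darboux_Phi z : N z -> euler_darboux (Phi K K) z = 0.
Proof.
move=> Nz; rewrite /euler_darboux.
have W x (Nx : N x) : is_wirt x (Phi K K) _ _ := is_wirt_Phi Nx (ltac:(lia) : K + K <= n)%N.
rewrite (is_wirt_dz (W z Nz)) (is_wirt_dzbar (W z Nz)).
rewrite (dz_ext oN (fun x Nx => is_wirt_dzbar (W x Nx)) Nz).
have W1 := is_wirt_Phi Nz (ltac:(lia) : K + K.-1 <= n)%N.
rewrite (is_wirt_dz (is_wirtN (is_wirtcM K%:R W1))).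
have [m Km] : exists m, K = m.+1 by exists K.-1; rewrite prednK.
rewrite Km /= !XsubC_pows_diag_horner.
(* From X - zbar = (X - z) + (z - zbar). *)
have -> : Phi m m.+1 z = Phi m.+1 m z + rr z * Phi m m z.
  rewrite /Phi -pairingZr -pairingDr; congr (pairing _ _ _).
  by rewrite /XsubC_pows -mul_polyC /rr polyCB !exprS; ring.
by ring.
Qed.
End Primitive.

Variables (f : C -> R) (h : C -> {poly C}).
Let F (z : C) : C := ofreal (f z).
Hypothesis sf : smooth N F.
Hypothesis f_eigen : forall z, N z -> laplacian F z = k%:R * (1 - k%:R) * F z.
Hypothesis hprim : primitive_on k N (omega k (deltan k F)) h.
Let D (z : C) : R :=
  (-1) ^+ K / K`!%:R * Re (pairing k (h z) (Qz z ^+ K)) - 2^-1 * f z.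
Let E (z : C) : C := rr z ^+ K * ofreal (D z).

(** The normalization of the theorem: the inverse of the factor (-1)^K K! in [iter_dz_Phi_top]. *)
Let c : C := (-1) ^+ K / K`!%:R.

(** The real part is half of the pairing plus its conjugate, and the extra (-1)^K arises because the
    conjugate of r is -r. The redundant [1 *] and the coefficient [- 2^-1] give the shape a f + b g
    of the linearity lemmas. *)
Lemma local_defectE z : N z -> E z =
  1 * (c / 2 * Phi h K K z + (c / 2 * (-1) ^+ K) * cbar (Phi h K K z)) +
  - 2^-1 * (rr z ^+ K * F z).
Proof.
move=> Nz; have r0 := rr_neq0 (N_upper Nz).
have rK0 : rr z ^+ K != 0 by rewrite expf_neq0.
have -> : Phi h K K z = rr z ^+ K * pairing k (h z) (Qz z ^+ K).
  by rewrite QzE pairingZr -/(rr z) mulVKf.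
rewrite cbarM cbarX cbar_rr /E /D ofrealD ofrealN !ofrealM !ofrealV ofrealX ofrealN !ofreal_nat -/(F z).
rewrite -[ofreal 1]/(1 : C) -/c.
set p := pairing _ _ _.
have -> : ofreal (Re p) = 2^-1 * (p + cbar p).
  rewrite addr_cbar -[Re p *+ 2]mulr_natl ofrealM ofreal_nat mulrA mulVf ?mul1r//.
have -> : (- rr z) ^+ K = (-1) ^+ K * rr z ^+ K by rewrite -exprMn mulN1r.
have e1 : (-1) ^+ K * (-1) ^+ K = 1 :> C by rewrite -exprMn mulrNN mulr1 expr1n.
transitivity (c / 2 * (rr z ^+ K * p) + (c / 2 * rr z ^+ K * ((-1) ^+ K * (-1) ^+ K)) * cbar p
  - 2^-1 * (rr z ^+ K * F z)); last by ring.
by rewrite e1; ring.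
Qed.

Let sP : smooth N (Phi h K K). Proof. exact: smooth_Phi hprim _ _. Qed.
Let scP : smooth N (fun z => cbar (Phi h K K z)). Proof. exact: smooth_cbar. Qed.
Let sPP : smooth N (fun z => c / 2 * Phi h K K z + (c / 2 * (-1) ^+ K) * cbar (Phi h K K z)).
Proof. by apply: smoothD => //; exact: smoothcM. Qed.
Let srF : smooth N (fun z => rr z ^+ K * F z).
Proof. by apply: smoothM => //; apply: smoothX => //; exact: smooth_rr. Qed.

Lemma smooth_local_defect : smooth N E.
Proof.
apply: (smooth_ext oN (fun z Nz => esym (local_defectE Nz))).
by apply: smoothD => //; exact: smoothcM.
Qed.

Lemma iter_dz_local_defect z : N z -> iter k dz E z = 0.
Proof.
move=> Nz; rewrite (iter_dz_ext oN _ (fun z Nz => local_defectE Nz) Nz).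
rewrite (iter_dzD oN _ _ _ sPP srF Nz) (iter_dzD oN _ _ _ sP scP Nz).
rewrite (iter_dz_Phi_top hprim Nz) (iter_dz_conj oN _ sP Nz) (iter_dzbar_Phi_top hprim Nz).
rewrite -(deltan_iter_dz oN K (fun x Nx => rr_neq0 (N_upper Nx)) sf Nz).
rewrite (cbar_ofreal 0) -[ofreal 0]/(0 : C) /c.
have e1 : (-1) ^+ K * (-1) ^+ K = 1 :> C by rewrite -exprMn mulrNN mulr1 expr1n.
have K1 : K`!%:R != 0 :> C by rewrite Rc_natr_eq0 -lt0n fact_gt0.
move: (deltan _ _ _) (rr z ^+ K) => d r; have t0 := @two_neq0 R.
transitivity (((-1) ^+ K * (-1) ^+ K) / 2 * d * r - 2^-1 * (r * d)).
  by move: (K`!%:R) K1 ((-1) ^+ K) => kk kk0 s; field; rewrite kk0.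
by rewrite e1; field.
Qed.

Lemma euler_darboux_local_defect z : N z -> euler_darboux E z = 0.
Proof.
move=> Nz; rewrite (euler_darboux_ext (fun z Nz => local_defectE Nz) Nz).
rewrite (euler_darboux_lin _ _ sPP srF Nz) (euler_darboux_lin _ _ sP scP Nz).
rewrite (euler_darboux_conj sP Nz) (euler_darboux_Phi hprim Nz) (euler_darboux_rrX sf Nz).
have -> : rr z ^+ 2 * dz (dzbar F) z = laplacian F z by [].
rewrite f_eigen// (cbar_ofreal 0) -[ofreal 0]/(0 : C) -[k%:R]natr1.
by ring.
Qed.
End LocalEquations.

(** * The upper half-plane *)

Section UpperHalfPlane.
Context {R : realType}.
Local Notation C := (Rcomplex R).
Local Notation Re := (@complex.Re R : C -> R).
Local Notation Im := (@complex.Im R : C -> R).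

(** A countable set is Lebesgue null, whereas a nonempty open interval is not. *)
Lemma countable_avoid (T : countType) (f : T -> R) (a b : R) : a < b ->
  exists2 y, a < y < b & forall t, f t <> y.
Proof.
move=> ab; apply: contrapT => none.
have cnt : countable (`]a, b[ : set R).
  apply: (@sub_countable _ _ _ (range f)); last first.
    by apply: (sub_countable (card_image_le f setT)); exact: countableP.
  apply: subset_card_le => y /=; rewrite in_itv /= => yab.
  by apply: contrapT => ny; apply: none; exists y => // t fty; apply: ny; exists t.
have := countable_lebesgue_measure0 cnt.
rewrite lebesgue_measure_itv /= lte_fin ab -EFinB => /eqP.
by rewrite eqe subr_eq0 gt_eqF.
Qed.

Lemma mobM (g h : 'M[int]_2) (z : C) : \det g = 1 -> \det h = 1 -> upper z ->
  upper (mob h z) -> mob (g * h) z = mob g (mob h z).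
Proof.
move=> dg dh uz uhz.
have den0 := mob_den_neq0 dh uz; have den1 := mob_den_neq0 dg uhz.
have E i j : (g * h) i j = g i 0 * h 0 j + g i 1 * h 1 j.
  rewrite mxE !big_ord_recl big_ord0 addr0 (_ : lift ord0 ord0 = 1)//; exact: val_inj.
have dgh : \det (g * h) = 1 by rewrite [LHS]det_mulmx dg dh mulr1.
have den2 := mob_den_neq0 dgh uz.
move: den0 den1 den2; rewrite /mob !E !rmorphD !rmorphM /=.
move: (g 0 0)%:~R (g 0 1)%:~R (g 1 0)%:~R (g 1 1)%:~R => a b c d.
move: (h 0 0)%:~R (h 0 1)%:~R (h 1 0)%:~R (h 1 1)%:~R => a' b' c' d'.
move=> den0 den1 den2.
have den3 : c * (a' * z + b') + d * (c' * z + d') != 0.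
  by apply: contraNneq den2 => e; apply/eqP; rewrite -[RHS]e; ring.
by field; rewrite ?den0 ?den2 ?den3.
Qed.

Lemma Im_mob (g : 'M[int]_2) (z : C) : \det g = 1 -> upper z ->
  Im (mob g z) = Im z / (((g 1 0)%:~R * Re z + (g 1 1)%:~R) ^+ 2 + ((g 1 0)%:~R * Im z) ^+ 2).
Proof.
move=> dg uz; have := mob_sub_cbar dg uz; rewrite !rrE mul_cbar -ofrealV => E.
have {E} := congr1 Im E; rewrite !(Rc_ReM, Rc_ImM, Rc_ReD, Rc_ImD) /= -!ofreal_int /=.
rewrite !(mulr0, mul0r, mulr1, addr0, add0r, subr0).
by rewrite mulrnAl => /eqP; rewrite eqrMn2r/= => /eqP.
Qed.

Lemma upper_mob (g : 'M[int]_2) (z : C) : \det g = 1 -> upper z -> upper (mob g z).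
Proof.
move=> dg uz; have := Im_mob dg uz; rewrite /upper /= => ->.
rewrite divr_gt0//; have := mob_den_neq0 dg uz.
set j := (_ * z + _) => j0.
rewrite lt_def addr_ge0 ?sqr_ge0// andbT; apply: contra j0.
rewrite paddr_eq0 ?sqr_ge0// !sqrf_eq0 => /andP[/eqP r0 /eqP i0].
apply/eqP; apply: eq_Rc; rewrite /j !(Rc_ReM, Rc_ImM, Rc_ReD, Rc_ImD) -!ofreal_int /=.
  by rewrite mul0r subr0 r0.
by rewrite mul0r addr0 i0 addr0.
Qed.

Lemma smooth_slice (S : set (C * C)%type) (f : (C * C)%type -> R) (U : set C) (w : C) :
  open U -> (forall z, U z -> S (z, w)) -> smooth S (f : _ -> R^o) ->
  smooth U (fun z => f (z, w) : R^o).
Proof.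
move=> oU US sf.
apply: (smooth_coind (S := fun g => exists2 f : (C * C)%type -> R^o, smooth S f & g = fun z => f (z, w))) => //; last by exists f.
move=> _ [g sg ->].
have gE z v : U z -> is_derive z v (fun z => g (z, w)) ('D_(v, 0) g (z, w)).
  move=> /US Sz; apply/is_derive_cvgP.
  have /is_derive_cvgP := smooth_is_derive (v, 0) sg Sz.
  rewrite (_ : (fun h : R => _) = (fun h : R => h^-1 *: (g (h *: v + z, w) - g (z, w)) : R^o))//.
  apply/funext => h.
  have -> : h *: ((v, 0) : (C * C)%type) + (z, w) = (h *: v + z, h *: (0 : C) + w) by [].
  by rewrite scaler0 add0r.
split=> [z Uz|z v /(gE z v)[]//|v].
  apply: (@continuous_comp _ _ _ (fun z : C => (z, w)) g); last exact: smooth_cont sg (US _ Uz).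
  have cw : {for z, continuous (cst w : C -> C)} by exact: cst_continuous.
  exact: (@cvg_pair C C C (nbhs z) (nbhs z) (nbhs w) _ _ _ id (cst w) (fun A zA => zA) cw).
exists (fun z => 'D_(v, 0) g (z, w)); last by move=> z /(gE z v)[_ ->].
by exists ('D_(v, 0) g) => //; exact: smooth_derive.
Qed.

(** To be applied with v = 1 and v = i, where the formula for ['D_v] follows from the definitions of
    dz and dzbar alone. *)
Lemma smooth_line_poly (U : set C) (E : C -> C) (K : nat) (c al be v x : C) (J : set R) :
  open U -> smooth U E -> (forall z, U z -> iter K.+1 dz E z = 0) ->
  (forall z, U z -> iter K.+1 dzbar E z = 0) ->
  (forall f z, 'D_v f z = al * dz f z + be * dzbar f z) ->
  (forall s t u, J s -> J u -> s <= t <= u -> J t) ->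
  (forall t, J t -> U (t *: v + x)) ->
  exists q : {poly R}, forall t, J t -> Re (c * E (t *: v + x)) = q.[t].
Proof.
move=> oU sE dE dbE DE cJ JU.
pose D (f : C -> C) : C -> C := 'D_v f.
have sD i : smooth U (iter i D E).
  exact: (smooth_iterD oU (DE : forall f z, D f z = al * dz f z + be * dzbar f z)).
(* The order 2K + 1 is the least m with (K + 1) + (K + 1) <= m + 1, as [iterD_eq0] asks. *)
apply: (@nilpotent_deriv_poly _ J (fun i t => Re (c * iter i D E (t *: v + x))) (2 * K).+1) => //.
  move=> i t Jt; have := smooth_is_derive v (sD i) (JU t Jt) => /is_derive_line dline.
  have := is_derive_RcM (is_derive_cst c t (1 : R)) dline; rewrite mul0r add0r.
  by move=> /is_derive_Rc[].
move=> t Jt; rewrite (@iterD_eq0 _ U oU D al be DE (2 * K).+1 K.+1 K.+1)//; first by rewrite mulr0.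
- by lia.
- exact: JU.
Qed.
End UpperHalfPlane.

(** * Vanishing of the defect *)

Section GreenDefect.
Context {R : realType}.
Local Notation C := (Rcomplex R).
Local Notation Re := (@complex.Re R : C -> R).
Local Notation Im := (@complex.Im R : C -> R).
Variables (K : nat) (K0 : (0 < K)%N).
Local Notation k := K.+1.
Variables (Gamma : set 'M[int]_2) (hGamma : congruence_subgroup Gamma).
Variables (z0 : C) (hz0 : upper z0) (G : C -> C -> R) (hG : is_green k Gamma G).
Variable I : C -> set {poly C}.
Let U := off_orbit Gamma z0.
Hypothesis hI : local_primitive k U (omega k (gk k G z0)) I.
Hypothesis hIGamma : forall (g : 'M[int]_2) (t : C),
  Gamma g -> U t -> I (mob g t) = act k g @` I t.

Let U_upper : U `<=` upper. Proof. by move=> z []. Qed.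

(** Read off from the open sets on which [hI] provides primitives. *)
Let oU : open U.
Proof.
rewrite openE => z /hI[N [h [oN Nz NU _ _]]].
by apply: filterS NU _; exact: open_nbhs_nbhs.
Qed.

Let F (z : C) : C := ofreal (G z z0).

Let smooth_F : smooth U F.
Proof.
apply: smooth_ofreal => //.
apply: (smooth_slice (f := fun p : (C * C)%type => G p.1 p.2) oU _ (green_smooth hG)).
by move=> z Uz.
Qed.

Let F_eigen z : U z -> laplacian F z = k%:R * (1 - k%:R) * F z.
Proof. by move=> Uz; exact: (green_eigen1 hG hz0 Uz). Qed.

Let pRe (p : {poly C}) (z : C) : R := Re (pairing k p (Qz z ^+ K)).

Lemma pRe_indep z p q : U z -> I z p -> I z q -> pRe p z = pRe q z.
Proof.
move=> Uz; have [N [h [_ Nz _ _ /(_ z Nz) ->]]] := hI Uz.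
by move=> cp cq; have := Re_pairing_coset (ltn0Sn K) (U_upper Uz) cp cq; rewrite subn1.
Qed.

Lemma I_nonempty z : U z -> exists p, I z p.
Proof.
move=> Uz; have [N [h [_ Nz _ _ /(_ z Nz) ->]]] := hI Uz.
exists (h z); exists 0; last by rewrite scaler0 addr0.
by split=> [|i]; rewrite ?coef0// /Vpoly /= size_poly0.
Qed.

(** An arbitrary representative of the coset is chosen at each point, with no regularity in z;
    [defectE] replaces it by any other, in particular by a smooth local primitive. *)
Let D (z : C) : R := (-1) ^+ K / K`!%:R * pRe (xget 0 (I z)) z - 2^-1 * G z z0.

Lemma defectE z p : U z -> I z p -> D z = (-1) ^+ K / K`!%:R * pRe p z - 2^-1 * G z z0.
Proof.
by move=> Uz Ip; rewrite /D (pRe_indep Uz (xgetPex 0 (I_nonempty Uz)) Ip).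
Qed.

Let E (z : C) : C := rr z ^+ K * ofreal (D z).

Lemma local_model z : U z -> exists (N : set C) (h : C -> {poly C}),
  [/\ open N, N z, N `<=` U, primitive_on k N (omega k (deltan k F)) h &
   forall s, N s -> E s = rr s ^+ K * ofreal ((-1) ^+ K / K`!%:R *
      Re (pairing k (h s) (Qz s ^+ K)) - 2^-1 * G s z0)].
Proof.
move=> Uz; have [N [h [oN Nz NU hN IN]]] := hI Uz; exists N, h; split => // s Ns.
rewrite /E (@defectE s (h s)) ?IN//; first exact: NU.
by exists 0; rewrite ?scaler0 ?addr0//; split=> [|i]; rewrite ?coef0// /Vpoly /= size_poly0.
Qed.

Let smooth_F_sub (N : set C) : N `<=` U -> smooth N F.
Proof. by move=> NU; exact: smooth_sub smooth_F. Qed.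

Lemma smooth_defect : smooth U E.
Proof.
apply: smooth_local => z Uz; have [N [h [oN Nz NU hN EN]]] := local_model Uz.
exists N; split => //.
apply: (smooth_ext oN (fun s Ns => esym (EN s Ns))).
exact: (smooth_local_defect oN (subset_trans NU U_upper) (smooth_F_sub NU) hN).
Qed.

Lemma iter_dz_defect z : U z -> iter k dz E z = 0.
Proof.
move=> Uz; have [N [h [oN Nz NU hN EN]]] := local_model Uz.
rewrite (iter_dz_ext oN k EN Nz).
exact: (iter_dz_local_defect (f := fun s => G s z0) K0 oN (subset_trans NU U_upper) (smooth_F_sub NU) hN Nz).
Qed.

Lemma iter_dzbar_defect z : U z -> iter k dzbar E z = 0.
Proof.
move=> Uz; apply/eqP; rewrite -cbar_eq0 -(iter_dz_conj oU k smooth_defect Uz); apply/eqP.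
(* The conjugate of E is (-1)^K E, because D is real; the summand with coefficient 0 only fits the
   shape of [iter_dzD]. *)
rewrite (_ : (fun x => _) = fun x => (-1) ^+ K * E x + 0 * E x).
  rewrite (iter_dzD oU _ _ _ smooth_defect smooth_defect Uz) iter_dz_defect//.
  by rewrite mul0r mulr0 addr0.
apply/funext => x; rewrite /E cbarM cbarX cbar_ofreal cbar_rr.
by rewrite mul0r addr0 mulrA -exprMn mulN1r.
Qed.

Lemma euler_darboux_defect z : U z -> euler_darboux K E z = 0.
Proof.
move=> Uz; have [N [h [oN Nz NU hN EN]]] := local_model Uz.
rewrite (euler_darboux_ext K oN EN Nz).
apply: (euler_darboux_local_defect (f := fun s => G s z0) K0 oN (subset_trans NU U_upper) (smooth_F_sub NU) _ hN) => //.
by move=> s /NU; exact: F_eigen.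
Qed.

Lemma mob_off_orbit g z : Gamma g -> U z -> U (mob g z).
Proof.
move=> Gg [uz zo]; have dg := cong_det hGamma Gg; split; first exact: upper_mob.
move=> [h Gh E1]; apply: zo; exists (g^-1 * h); first exact: cong_M (cong_V hGamma Gg) Gh.
have GV := cong_V hGamma Gg; have dV := cong_det hGamma GV; have dh := cong_det hGamma Gh.
rewrite mobM//; last exact: upper_mob.
rewrite -E1 -mobM//; last exact: upper_mob.
rewrite mulVr; last by rewrite -[_ \is a _]/(g \in unitmx) unitmxE dg unitr1.
by rewrite /mob !mxE /= mul0r mul1r add0r addr0 divr1.
Qed.

Lemma defect_mob g z : Gamma g -> U z -> D (mob g z) = D z.
Proof.
move=> Gg Uz; have [p Ip] := I_nonempty Uz.
have Iq : I (mob g z) (act k g p) by rewrite hIGamma//; exists p.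
rewrite (defectE Uz Ip) (defectE (mob_off_orbit Gg Uz) Iq) (green_inv1 hG hz0 Uz Gg).
have := @pairing_act R k g p z (ltn0Sn K) (cong_det hGamma Gg) (U_upper Uz).
by rewrite subn1 /= /pRe => ->.
Qed.

(** A multiple M of the level in one off-diagonal entry gives a unipotent matrix of the principal
    congruence subgroup. The condition a b = 0 covers upper and lower shears at once. *)
Lemma shear_in (a b : int) : a * b = 0 -> exists2 M : nat, (0 < M)%N &
  Gamma (\matrix_(i, j) if i == j then 1 else if i == 0 then a * M%:Z else b * M%:Z).
Proof.
move=> ab; have [M M0 HM] := cong_level hGamma; exists M => //.
apply: HM => [|i j].
  rewrite det_mx2 !mxE /=.
  by rewrite mulrACA ab mul0r mulr1 subr0.
rewrite !mxE; case: (i == j); first by rewrite subrr dvdz0.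
by rewrite subr0; case: (i == 0); exact: dvdz_mull.
Qed.

Lemma defect_translate : exists2 M : nat, (0 < M)%N &
  forall z, U z -> D (z + M%:R) = D z.
Proof.
have [M M0 GM] := shear_in (mulr0 1).
exists M => // z Uz; rewrite -[RHS](defect_mob GM Uz) /mob !mxE /=; congr D.
by rewrite (mul0r (M : int)) (mul1r (M : int)) mulr0z !mulr1z mul0r add0r divr1 mul1r.
Qed.

Lemma defect_lower : exists2 M : nat, (0 < M)%N &
  forall z, U z -> [/\ U (z / (M%:R * z + 1)), D (z / (M%:R * z + 1)) = D z &
    Im (z / (M%:R * z + 1)) = Im z / ((M%:R * Re z + 1) ^+ 2 + (M%:R * Im z) ^+ 2)].
Proof.
have [M M0 GM] := shear_in (mul0r 1).
exists M => // z Uz.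
have := defect_mob GM Uz; have := mob_off_orbit GM Uz.
have := Im_mob (cong_det hGamma GM) (U_upper Uz).
by rewrite /mob !mxE /= (mul0r (M : int)) (mul1r (M : int)) !mulr0z !mulr1z mul1r addr0.
Qed.

(** Indexed by all integral matrices, a countable type as in [countable_avoid]; the values include
    those taken on the orbit. *)
Let orbit_Re (g : 'M[int]_2) : R := Re (mob g z0).
Let orbit_Im (g : 'M[int]_2) : R := Im (mob g z0).

Lemma off_orbit_Re (x y : R) : 0 < y -> (forall g, orbit_Re g <> x) -> U (Complex x y).
Proof. by move=> y0 nx; split => // -[g _ zE]; apply: (nx g); rewrite /orbit_Re -zE. Qed.

Lemma off_orbit_Im (x y : R) : 0 < y -> (forall g, orbit_Im g <> y) -> U (Complex x y).
Proof. by move=> y0 ny; split => // -[g _ zE]; apply: (ny g); rewrite /orbit_Im -zE. Qed.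

(** Since r = 2 i y, the constant (2 i)^-K turns r^K into y^K. *)
Lemma Re_defect (z : C) : Re ((2%:R * ii) ^- K * E z) = Im z ^+ K * D z.
Proof.
have i0 : (2%:R * ii : C) != 0.
  rewrite mulf_neq0 ?two_neq0//; apply/eqP => /(congr1 Im) /eqP.
  by rewrite /= oner_eq0.
rewrite /E /rr rrE.
have -> : ofreal (Im z *+ 2) * ii = (2%:R * ii) * ofreal (Im z).
  by rewrite -[Im z *+ 2]mulr_natl ofrealM ofreal_nat; ring.
move: (2%:R * ii) i0 => w w0.
by rewrite exprMn -mulrA mulKf ?expf_neq0// -ofrealX -ofrealM.
Qed.

(** The whole line at height y avoids the orbit, so D is a polynomial in Re z there; being
    M-periodic, it takes its value at 0 at all multiples of M and is constant. *)
Lemma horizontal_const (y x x' : R) : 0 < y -> (forall g, orbit_Im g <> y) ->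
  D (Complex x y) = D (Complex x' y).
Proof.
move=> y0 ny.
have lineE (t : R) : t *: (1 : C) + (Complex 0 y : C) = Complex t y.
  by apply: eq_Rc; rewrite /= ?mulr1 ?mulr0 ?addr0 ?add0r.
have [||t _|q qE] := @smooth_line_poly R U E K ((2%:R * ii) ^- K) 1 1 1 (Complex 0 y) setT oU
  smooth_defect iter_dz_defect iter_dzbar_defect.
- by move=> f z; rewrite derive_1E !mul1r.
- by [].
- by rewrite lineE; exact: off_orbit_Im.
have {}qE t : y ^+ K * D (Complex t y) = q.[t] by rewrite -qE// lineE Re_defect.
have [M M0 DM] := defect_translate.
have yK0 : y ^+ K != 0 by rewrite expf_neq0// gt_eqF.
have qM t : q.[t + M%:R] = q.[t].
  rewrite -!qE; congr (_ * _).
  rewrite -[RHS]DM; last exact: off_orbit_Im.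
  by congr D; apply: eq_Rc; rewrite -ofreal_nat /= ?addr0.
have qc : q = (q.[0])%:P.
  apply: (@poly_eq_on _ (fun m => m%:R * M%:R)).
    by move=> m m' /= /mulIf; rewrite pnatr_eq0 -lt0n M0 => /(_ isT)/eqP; rewrite eqr_nat => /eqP.
  elim=> [|m IH]; first by rewrite mul0r hornerC.
  by rewrite -natr1 mulrDl mul1r qM IH !hornerC.
by apply: (mulfI yK0); rewrite !qE qc !hornerC.
Qed.

(** One vertical line avoiding the orbit defines q. Points at a good height are moved to it by
    [horizontal_const]; the others are limits of such points. *)
Lemma defect_poly : exists q : {poly R}, forall z, U z -> Im z ^+ K * D z = q.[Im z].
Proof.
have [x _ nx] := countable_avoid orbit_Re (@ltr01 R).
have lineE (t : R) : t *: (ii : C) + (Complex x 0 : C) = Complex x t.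
  by apply: eq_Rc; rewrite /= ?mulr1 ?mulr0 ?addr0 ?add0r.
have [|s t u /= s0 u0 /andP[st _]|t /= t0|q qE] := @smooth_line_poly R U E K ((2%:R * ii) ^- K) ii (- ii) ii (Complex x 0) [set t | 0 < t] oU
  smooth_defect iter_dz_defect iter_dzbar_defect.
- by move=> f z; rewrite derive_iiE mulrBr mulNr.
- exact: lt_le_trans st.
- by rewrite lineE; exact: off_orbit_Re.
have {}qE t : 0 < t -> t ^+ K * D (Complex x t) = q.[t].
  by move=> t0; rewrite -qE// lineE Re_defect.
exists q => z Uz; set y := Im z; have y0 : 0 < y := U_upper Uz.
(* The difference to be killed, along the vertical through z. That line may meet the orbit, but
   [phi] is continuous at 0 and vanishes at arbitrarily small t > 0 for which y + t is a good
   height. *)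
pose phi (t : R) := Re ((2%:R * ii) ^- K * E (t *: (ii : C) + z)) - q.[y + t].
have phiE (t : R) : 0 < y + t -> (forall g, orbit_Im g <> y + t) -> phi t = 0.
  move=> yt0 nyt; rewrite /phi Re_defect.
  have -> : t *: (ii : C) + z = Complex (Re z) (y + t).
    by apply: eq_Rc; rewrite !(Rc_ReD, Rc_ImD) !(Rc_ReZ, Rc_ImZ) /= ?mulr0 ?mulr1 ?add0r// addrC.
  by rewrite (horizontal_const (Re z) x yt0 nyt) qE ?subrr.
have cphi : {for 0, continuous phi}.
  have cE : {for 0 *: (ii : C) + z, continuous (fun z => (2%:R * ii) ^- K * E z)}.
    rewrite scale0r add0r.
    exact: (smooth_cont (smoothcM _ oU smooth_defect) Uz).
  have [cRe _] := (cvg_Rc _ _ _).1 (continuous_line cE).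
  apply: cvgB; first exact: cRe.
  apply: continuous_comp; last exact: continuous_horner.
  by apply: cvgD; [exact: cvg_cst|exact: cvg_id].
suff : phi 0 = 0 by rewrite /phi scale0r add0r addr0 Re_defect => /eqP; rewrite subr_eq0 => /eqP.
apply/eqP; rewrite -normr_le0; apply/ler_addgt0Pl => e e0; rewrite addr0.
have : \forall t \near (0 : R), `|phi 0 - phi t| <= e.
  by move/cvgrPdist_le : cphi; apply.
move=> /nbhs_ballP[d /= d0 dphi].
have [|t /andP[yt td] nt] := @countable_avoid R _ orbit_Im y (y + d); first by rewrite ltrDl.
have tE : y + (t - y) = t by rewrite addrC subrK.
have -> : phi 0 = phi 0 - phi (t - y).
  by rewrite (phiE (t - y)) ?subr0// tE// (lt_trans y0).
apply: dphi; rewrite -ball_normE /ball_ /= sub0r normrN gtr0_norm ?subr_gt0//.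
by rewrite ltrBlDl.
Qed.

(** D equals a constant d on one good horizontal line. A lower shear carries that line to points of
    varying height where D is still d, so q(s) = d s^K for infinitely many heights s. *)
Lemma defect_const : exists d : R, forall z, U z -> D z = d.
Proof.
have [q qE] := defect_poly; have [M M0 DM] := defect_lower.
have [y /andP[y0 _] ny] := countable_avoid orbit_Im (@ltr01 R).
(* The height of the image of m + i y under the lower shear; it is injective in m because M m + 1 is
   nonnegative and increasing. *)
pose s (m : nat) : R := y / ((M%:R * m%:R + 1) ^+ 2 + (M%:R * y) ^+ 2).
have Mp : 0 < M%:R :> R by rewrite ltr0n.
have den0 (m : nat) : 0 < (M%:R * m%:R + 1) ^+ 2 + (M%:R * y) ^+ 2 :> R.
  by rewrite ltr_wpDl ?sqr_ge0// exprn_gt0// mulr_gt0.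
pose d := D (Complex 0 y).
have qs m : q.[s m] = (d *: 'X^K).[s m].
  have Uxy : U (Complex m%:R y) by exact: off_orbit_Im.
  have [Ul Dl Il] := DM _ Uxy.
  have := qE _ Ul; rewrite Dl Il /= -/(s m) (horizontal_const _ 0 y0 ny) => <-.
  by rewrite hornerZ hornerXn mulrC.
have sinj : injective s.
  move=> m m' /(mulfI (lt0r_neq0 y0)) /invr_inj /addIr /eqP.
  have p0 (i : nat) : 0 <= M%:R * i%:R + 1 :> R by rewrite addr_ge0// mulr_ge0.
  rewrite eqrXn2// => /eqP /addIr /(mulfI (lt0r_neq0 Mp)) /eqP.
  by rewrite eqr_nat => /eqP.
have {}qE z : U z -> Im z ^+ K * D z = Im z ^+ K * d.
  by move=> Uz; rewrite qE// (poly_eq_on sinj qs) hornerZ hornerXn mulrC.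
exists d => z Uz; apply: (@mulfI _ (Im z ^+ K)); last exact: qE.
by rewrite expf_neq0// gt_eqF// (U_upper Uz).
Qed.

Lemma defect_eq0 z : U z -> D z = 0.
Proof.
move=> Uz; have [d dE] := defect_const; rewrite dE//.
have scst : smooth U (cst (ofreal d) : C -> C) by exact: smooth_cst.
have := euler_darboux_defect Uz.
rewrite (euler_darboux_ext (g := fun x => rr x ^+ K * cst (ofreal d) x) K oU _ Uz); last first.
  by move=> x Ux; rewrite /E dE.
(* For a constant function the equation reduces to r^(K-1) k K d = 0. *)
rewrite (euler_darboux_rrX K0 oU scst Uz).
have dbar0 x : dzbar (cst (ofreal d) : C -> C) x = cst 0 x.
  by rewrite (is_wirt_dzbar (is_wirt_cst x (ofreal d))).
rewrite (dz_ext oU (fun x _ => dbar0 x) Uz) (is_wirt_dz (is_wirt_cst z 0)) mulr0 addr0.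
have r0 : rr z ^+ K.-1 != 0 by rewrite expf_neq0// rr_neq0//; exact: U_upper.
move=> /eqP; rewrite mulf_eq0 (negbTE r0) /= mulf_eq0 -natrM Rc_natr_eq0.
rewrite muln_eq0 /= (gtn_eqF K0) /= => /eqP; exact: ofreal_inj.
Qed.

Lemma green_eq_pairing z p : U z -> I z p ->
  2^-1 * G z z0 = (-1) ^+ K / K`!%:R * Re (pairing k p (Qz z ^+ K)).
Proof.
by move=> Uz Ip; have := defect_eq0 Uz; rewrite (defectE Uz Ip) => /eqP; rewrite subr_eq0 => /eqP.
Qed.

End GreenDefect.

Theorem theorem1p5p4 (R : realType) (k : nat) (hk : (1 < k)%N)
  (Gamma : set 'M[int]_2) (hGamma : congruence_subgroup Gamma)
  (z0 : Rcomplex R) (hz0 : upper z0)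
  (G : Rcomplex R -> Rcomplex R -> R) (hG : is_green k Gamma G)
  (I : Rcomplex R -> set {poly Rcomplex R})
  (hI : local_primitive k (off_orbit Gamma z0) (omega k (gk k G z0)) I)
  (hIGamma : forall (g : 'M[int]_2) (t : Rcomplex R),
     Gamma g -> off_orbit Gamma z0 t -> I (mob g t) = act k g @` I t) :
  forall z : Rcomplex R, off_orbit Gamma z0 z ->
  forall p : {poly Rcomplex R}, I z p ->
    2^-1 * G z z0 =
    (-1) ^+ (k - 1) / ((k - 1)`!)%:R * complex.Re (pairing k p (Qz z ^+ (k - 1))).
Proof.
case: k hk hG hI hIGamma => // K K0 hG hI hIGamma z Uz p Ip; rewrite subn1 /=.
exact: (green_eq_pairing K0 hGamma hz0 hG hI hIGamma Uz Ip).
Qed.
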